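(* Let $h_n>0$, $T=nh_n$ and $\alpha\in(0,1)$. Assume that each of the drifts $B_1,\dots,B_4$ is globally Lipschitz and of class $C^4$ with all partial derivatives of order $0$ to $4$ of polynomial growth, that $\sup_{t}\mathbb{E}[|Y_t|^{\ell}]<\infty$ for all $\ell\ge 0$ and each $Y\in\{\xi_0,\delta_0,\varepsilon_0,\zeta_0\}$, and that each such $Y$ is ergodic with an invariant measure $\pi_Y$: for every $\pi_Y$-integrable $g$, $\frac1T\int_0^Tg(Y_t)dt\to\int g\,d\pi_Y$ in probability as $T\to\infty$. Assume $H_1$: $\mathbf{\Sigma}_0\ne\mathbf{\Sigma}(\theta)$ for every $\theta\in\Theta$. Suppose that the function $\mathbb{U}(\theta)=\mathrm{F}(\mathbf{\Sigma}_0,\mathbf{\Sigma}(\theta))$ has a unique minimizer $\bar\theta$ on $\Theta$. Then, as $h_n\to0$ and $nh_n\to\infty$, with $\mathbb{T}_n=n\mathbb{F}_n(\hat\theta_n)$, $$\mathbb{P}\bigl(\mathbb{T}_n>\chi^2_{\bar p-q}(\alpha)\bigr)\to1.$$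
   Context: Notation: $\operatorname{vech}$ is half-vectorization; $\chi^2_r(\alpha)$ is the upper $\alpha$ point of the chi-squared distribution with $r$ degrees of freedom (degrees of freedom are understood to be positive). True model and data: $p_1,p_2,k_1,k_2,r_1,\dots,r_4\ge 1$ are fixed integers with $k_1\le p_1$, $k_2\le p_2$; $p=p_1+p_2$, $\bar p=p(p+1)/2$. $W_1,\dots,W_4$ are independent standard Wiener processes of dimensions $r_1,\dots,r_4$. The latent processes $\xi_0,\delta_0,\varepsilon_0,\zeta_0$, with values in $\mathbb{R}^{k_1},\mathbb{R}^{p_1},\mathbb{R}^{p_2},\mathbb{R}^{k_2}$, solve for $t\ge0$: $d\xi_{0,t}=B_1(\xi_{0,t})dt+\mathbf{S}_{1,0}dW_{1,t}$, $d\delta_{0,t}=B_2(\delta_{0,t})dt+\mathbf{S}_{2,0}dW_{2,t}$, $d\varepsilon_{0,t}=B_3(\varepsilon_{0,t})dt+\mathbf{S}_{3,0}dW_{3,t}$, $d\zeta_{0,t}=B_4(\zeta_{0,t})dt+\mathbf{S}_{4,0}dW_{4,t}$, with deterministic initial values $c_1,\dots,c_4$ and constant matrices $\mathbf{S}_{i,0}$. Put $\mathbf{\Sigma}_{\xi\xi,0}=\mathbf{S}_{1,0}\mathbf{S}_{1,0}^\top$, $\mathbf{\Sigma}_{\delta\delta,0}=\mathbf{S}_{2,0}\mathbf{S}_{2,0}^\top$, $\mathbf{\Sigma}_{\varepsilon\varepsilon,0}=\mathbf{S}_{3,0}\mathbf{S}_{3,0}^\top$, $\mathbf{\Sigma}_{\zeta\zeta,0}=\mathbf{S}_{4,0}\mathbf{S}_{4,0}^\top$;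 $\mathbf{\Sigma}_{\delta\delta,0}$ and $\mathbf{\Sigma}_{\varepsilon\varepsilon,0}$ are positive definite. Constant matrices: $\mathbf{\Lambda}_{x_1,0}\in\mathbb{R}^{p_1\times k_1}$ of full column rank, $\mathbf{\Lambda}_{x_2,0}\in\mathbb{R}^{p_2\times k_2}$, $\mathbf{\Gamma}_0\in\mathbb{R}^{k_2\times k_1}$, $\mathbf{B}_0\in\mathbb{R}^{k_2\times k_2}$ with zero diagonal, $\mathbf{\Psi}_0=\mathbb{I}_{k_2}-\mathbf{B}_0$ non-singular. The observed process is $\mathbb{X}_t=(\mathbb{X}_{1,t}^\top,\mathbb{X}_{2,t}^\top)^\top$ with $\mathbb{X}_{1,t}=\mathbf{\Lambda}_{x_1,0}\xi_{0,t}+\delta_{0,t}$, $\mathbb{X}_{2,t}=\mathbf{\Lambda}_{x_2,0}\eta_{0,t}+\varepsilon_{0,t}$, $\eta_{0,t}=\mathbf{B}_0\eta_{0,t}+\mathbf{\Gamma}_0\xi_{0,t}+\zeta_{0,t}$. With $t_i^n=ih_n$, $T=nh_n$, $\mathbb{Q}_{\mathbb{XX}}=\frac1T\sum_{i=1}^n(\mathbb{X}_{t_i^n}-\mathbb{X}_{t_{i-1}^n})(\mathbb{X}_{t_i^n}-\mathbb{X}_{t_{i-1}^n})^\top$. Parametric model: $\Theta\subset\mathbb{R}^q$ is convex and compact. For $\theta\in\Theta$ there are matrices $\mathbf{\Lambda}_{x_1},\mathbf{\Lambda}_{x_2},\mathbf{\Gamma},\mathbf{\Psi}=\mathbb{I}_{k_2}-\mathbf{B}$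 ($\mathbf{B}$ with zero diagonal), $\mathbf{\Sigma}_{\xi\xi},\mathbf{\Sigma}_{\delta\delta},\mathbf{\Sigma}_{\varepsilon\varepsilon},\mathbf{\Sigma}_{\zeta\zeta}$ of respective sizes $p_1\times k_1$, $p_2\times k_2$, $k_2\times k_1$, $k_2\times k_2$, $k_1\times k_1$, $p_1\times p_1$, $p_2\times p_2$, $k_2\times k_2$, each entry being either a known constant or a coordinate of $\theta$ ($\theta$ collects the unknown, non-duplicated entries); $\mathbf{\Lambda}_{x_1}$ has full column rank, $\mathbf{\Psi}$ is non-singular, $\mathbf{\Sigma}_{\xi\xi},\mathbf{\Sigma}_{\zeta\zeta}$ are positive semidefinite, $\mathbf{\Sigma}_{\delta\delta},\mathbf{\Sigma}_{\varepsilon\varepsilon}$ positive definite. $\mathbf{\Sigma}(\theta)$ is the symmetric $p\times p$ matrix with blocks $\mathbf{\Sigma}^{11}=\mathbf{\Lambda}_{x_1}\mathbf{\Sigma}_{\xi\xi}\mathbf{\Lambda}_{x_1}^\top+\mathbf{\Sigma}_{\delta\delta}$, $\mathbf{\Sigma}^{12}=\mathbf{\Lambda}_{x_1}\mathbf{\Sigma}_{\xi\xi}\mathbf{\Gamma}^\top\mathbf{\Psi}^{-1\top}\mathbf{\Lambda}_{x_2}^\top$, $\mathbf{\Sigma}^{22}=\mathbf{\Lambda}_{x_2}\mathbf{\Psi}^{-1}(\mathbf{\Gamma}\mathbf{\Sigma}_{\xi\xi}\mathbf{\Gamma}^\top+\mathbf{\Sigma}_{\zeta\zeta})\mathbf{\Psi}^{-1\top}\mathbf{\Lambda}_{x_2}^\top+\mathbf{\Sigma}_{\varepsilon\varepsilon}$;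 $\mathbf{\Sigma}_0$ is the same expression evaluated at the true matrices (subscript $0$). Contrast and estimator: $\mathrm{F}(Q,\mathbf{\Sigma})=\log\det\mathbf{\Sigma}-\log\det Q+\operatorname{tr}(\mathbf{\Sigma}^{-1}Q)-p$ for $Q,\mathbf{\Sigma}$ positive definite. $\mathbb{F}_n(\theta)=\mathrm{F}(\mathbb{Q}_{\mathbb{XX}},\mathbf{\Sigma}(\theta))$ if $\mathbb{Q}_{\mathbb{XX}}$ is non-singular and $\mathbb{F}_n(\theta)=|\operatorname{vech}\mathbb{Q}_{\mathbb{XX}}-\operatorname{vech}\mathbf{\Sigma}(\theta)|^2$ otherwise. $\hat\theta_n\in\Theta$ is a minimum contrast estimator: $\mathbb{F}_n(\hat\theta_n)=\inf_{\theta\in\Theta}\mathbb{F}_n(\theta)$. *)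

(* Defs.v *)
From HB Require Import structures.
From mathcomp Require Import all_boot all_order all_algebra.
From mathcomp Require Import all_classical all_reals all_analysis.
Set Implicit Arguments.
Unset Strict Implicit.
Unset Printing Implicit Defensive.
Import Order.TTheory GRing.Theory Num.Theory.
Import numFieldNormedType.Exports.
Local Open Scope classical_set_scope.
Local Open Scope ring_scope.

(* Euclidean norm: the library's norm on matrices is the max norm. *)
Definition enorm {R : realType} {d : nat} (v : 'cV[R]_d) : R :=
  Num.sqrt (\sum_(i < d) v i 0 ^+ 2).

Definition psd {R : realType} {d : nat} (M : 'M[R]_d) : Prop :=
  M^T = M /\ forall v : 'cV[R]_d, 0 <= (v^T *m M *m v) 0 0.

Definition posdef {R : realType} {d : nat} (M : 'M[R]_d) : Prop :=
  M^T = M /\ forall v : 'cV[R]_d, v != 0 -> 0 < (v^T *m M *m v) 0 0.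

(* The pairs (j, i) with j <= i are enumerated lexicographically and contribute
   the entry M i j: the lower triangle is stacked column by column. *)
Definition vech {R : realType} {p : nat} (M : 'M[R]_p) :
    'cV[R]_#|[pred u : 'I_p * 'I_p | (u.1 <= u.2)%N]| :=
  \col_k M (enum_val k).2 (enum_val k).1.

Definition Gamma {R : realType} (a : R) : R :=
  \int[@lebesgue_measure R]_(x in `]0, +oo[) (x `^ (a - 1) * expR (- x)).

Definition chi2_pdf {R : realType} (r : nat) (x : R) : R :=
  if 0 < x then x `^ (r%:R / 2 - 1) * expR (- x / 2)
                / (2 `^ (r%:R / 2) * Gamma (r%:R / 2 : R))
  else 0.

Definition chi2_tail {R : realType} (r : nat) (c : R) : \bar R :=
  (\int[@lebesgue_measure R]_(x in `]c, +oo[) (chi2_pdf r x)%:E)%E.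

(* For 0 < r and 0 < alpha < 1 there is exactly one such c. *)
Definition chi2_upper {R : realType} (r : nat) (alpha : R) : R :=
  get [set c : R | chi2_tail r c = alpha%:E].

(* R^d (or a space of matrices) with its Borel sigma-algebra. *)
Notation borelType T := (g_sigma_algebraType (@open T)).

(* [I] is finite and each [G i] is meant to contain the whole space, so the
   product rule over subfamilies of [I] is included. *)
Definition independent {R : realType} {dO : measure_display}
    {Omega : measurableType dO} (P : probability Omega R) {I : finType}
    (G : I -> set (set Omega)) : Prop :=
  forall A : I -> set Omega, (forall i, G i (A i)) ->
    (P (\bigcap_(i in [set: I]) A i) = \prod_(i : I) P (A i))%E.

Definition sigma_process {R : realType} {dO : measure_display}
    {Omega : measurableType dO} {d : nat} (Y : R -> Omega -> 'cV[R]_d) :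
    set (set Omega) :=
  <<s \bigcup_(t in [set t : R | 0 <= t])
        preimage_set_system [set: Omega] (Y t)
          (@measurable _ (borelType 'cV[R]_d)) >>.

(* Processes are indexed by R, but only the times t >= 0 are ever constrained
   or used. *)
Definition measurable_process {R : realType} {dO : measure_display}
    {Omega : measurableType dO} {d : nat} (Y : R -> Omega -> 'cV[R]_d) : Prop :=
  forall t, 0 <= t ->
    @measurable_fun _ _ Omega (borelType 'cV[R]_d) [set: Omega] (Y t).

Definition continuous_paths {R : realType} {dO : measure_display}
    {Omega : measurableType dO} (P : probability Omega R) {d : nat}
    (Y : R -> Omega -> 'cV[R]_d) : Prop :=
  {ae P, forall w, {within `[0, +oo[, continuous (fun t : R => Y t w)}}.

Record wiener {R : realType} {dO : measure_display}
    {Omega : measurableType dO} (P : probability Omega R) {r : nat}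
    (W : R -> Omega -> 'cV[R]_r) : Prop := Wiener {
  wiener_measurable : measurable_process W ;
  wiener_start : {ae P, forall w, W 0 w = 0} ;
  wiener_continuous : continuous_paths P W ;
  wiener_increment : forall (s t : R) (j : 'I_r), 0 <= s -> s < t ->
    forall A : set R, measurable A ->
      P [set w | A (W t w j 0 - W s w j 0)] =
        normal_prob 0 (Num.sqrt (t - s)) A ;
  (* joint independence over time intervals and coordinates *)
  wiener_independent : forall (n : nat) (t : nat -> R),
    0 <= t 0%N -> (forall i, t i <= t i.+1) ->
    independent P (fun u : 'I_n * 'I_r =>
      preimage_set_system [set: Omega]
        (fun w => W (t u.1.+1) w u.2 0 - W (t u.1) w u.2 0)
        (@measurable _ R)) }.

(* Strong solution of dY_t = B(Y_t) dt + S dW_t, Y_0 = c.  Since S is constant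
   the stochastic integral of S is S W_t, so the integral equation is pathwise
   and only involves a Lebesgue integral of a continuous path. *)
Definition sde_solution {R : realType} {dO : measure_display}
    {Omega : measurableType dO} (P : probability Omega R) {d r : nat}
    (B : 'cV[R]_d -> 'cV[R]_d) (S : 'M[R]_(d, r)) (W : R -> Omega -> 'cV[R]_r)
    (c : 'cV[R]_d) (Y : R -> Omega -> 'cV[R]_d) : Prop :=
  [/\ measurable_process Y,
      continuous_paths P Y &
      {ae P, forall w, forall t : R, 0 <= t ->
        Y t w = c
          + (\col_i (\int[@lebesgue_measure R]_(s in `[0, t]) B (Y s w) i 0))
          + S *m W t w}].

(* Iterated partial derivative along the coordinates listed in [s]. *)
Definition partial {R : realType} {d : nat} (s : seq 'I_d)
    (f : 'cV[R]_d -> R) : 'cV[R]_d -> R :=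
  foldr (fun i (g : 'cV[R]_d -> R) (x : 'cV[R]_d) =>
           derive g x (delta_mx i 0 : 'cV[R]_d)) f s.

Definition class_C {R : realType} {d : nat} (k : nat) (f : 'cV[R]_d -> R) :
    Prop :=
  forall s : seq 'I_d, (size s <= k)%N ->
    continuous (partial s f) /\
    ((size s < k)%N -> forall (i : 'I_d) (x : 'cV[R]_d),
       derivable (partial s f) x (delta_mx i 0 : 'cV[R]_d)).

Definition poly_growth {R : realType} {d : nat} (f : 'cV[R]_d -> R) : Prop :=
  exists (C : R) (m : nat), forall x, `|f x| <= C * (1 + enorm x) ^+ m.

Definition regular_drift {R : realType} {d : nat}
    (B : 'cV[R]_d -> 'cV[R]_d) : Prop :=
  (exists K : R, forall x y, enorm (B x - B y) <= K * enorm (x - y)) /\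
  forall i : 'I_d, class_C 4 (fun x => B x i 0) /\
    forall s : seq 'I_d, (size s <= 4)%N ->
      poly_growth (partial s (fun x => B x i 0)).

Definition bounded_moments {R : realType} {dO : measure_display}
    {Omega : measurableType dO} (P : probability Omega R) {d : nat}
    (Y : R -> Omega -> 'cV[R]_d) : Prop :=
  forall l : R, 0 <= l ->
    (ereal_sup [set 'E_P[fun w => (enorm (Y t w) `^ l)%R]
               | t in [set t : R | (0 <= t)%R]] < +oo)%E.

(* Invariance under the transition probabilities x |-> law of Y^x_t, where Y^x
   is the solution started at x (unique up to indistinguishability when B is
   Lipschitz). *)
Definition invariant_law {R : realType} {dO : measure_display}
    {Omega : measurableType dO} (P : probability Omega R) {d r : nat}
    (B : 'cV[R]_d -> 'cV[R]_d) (S : 'M[R]_(d, r)) (W : R -> Omega -> 'cV[R]_r)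
    (nu : probability (borelType 'cV[R]_d) R) : Prop :=
  forall Y : 'cV[R]_d -> R -> Omega -> 'cV[R]_d,
    (forall x, sde_solution P B S W x (Y x)) ->
    forall (t : R) (A : set (borelType 'cV[R]_d)), 0 <= t -> measurable A ->
      (\int[nu]_x P [set w | A (Y x t w)] = nu A)%E.

(* Convergence in probability is expressed with the outer measure of P, which
   coincides with P on events: for a merely nu-integrable g and paths that are
   only almost surely continuous, the deviation set need not be an event. *)
Definition ergodic_average {R : realType} {dO : measure_display}
    {Omega : measurableType dO} (P : probability Omega R) {d : nat}
    (Y : R -> Omega -> 'cV[R]_d)
    (nu : probability (borelType 'cV[R]_d) R) : Prop :=
  forall g : borelType 'cV[R]_d -> R, nu.-integrable setT (EFin \o g) ->
  forall e : R, 0 < e ->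
    (mu_ext P [set w | e%:E <=
        `| (T^-1)%:E * (\int[@lebesgue_measure R]_(t in `[0%R, T]) (g (Y t w))%:E)
           - \int[nu]_x (g x)%:E |]
       @[T --> +oo%R] --> 0)%E.

Definition ergodic {R : realType} {dO : measure_display}
    {Omega : measurableType dO} (P : probability Omega R) {d r : nat}
    (B : 'cV[R]_d -> 'cV[R]_d) (S : 'M[R]_(d, r)) (W : R -> Omega -> 'cV[R]_r)
    (Y : R -> Omega -> 'cV[R]_d) : Prop :=
  exists nu : probability (borelType 'cV[R]_d) R,
    invariant_law P B S W nu /\ ergodic_average P Y nu.

(* The eight matrices of the structural equation model, with entries in an
   arbitrary type: T = R for actual matrices, T = R + 'I_q for the parametric
   model. *)
Record sem (T : Type) (p1 p2 k1 k2 : nat) := Sem {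
  Lx1 : 'M[T]_(p1, k1) ;
  Lx2 : 'M[T]_(p2, k2) ;
  Gam : 'M[T]_(k2, k1) ;
  Psi : 'M[T]_k2 ;
  Sxi : 'M[T]_k1 ;
  Sdelta : 'M[T]_p1 ;
  Seps : 'M[T]_p2 ;
  Szeta : 'M[T]_k2 }.

Definition sem_map (T U : Type) (f : T -> U) (p1 p2 k1 k2 : nat)
    (m : sem T p1 p2 k1 k2) : sem U p1 p2 k1 k2 :=
  Sem (map_mx f (Lx1 m)) (map_mx f (Lx2 m)) (map_mx f (Gam m))
      (map_mx f (Psi m)) (map_mx f (Sxi m)) (map_mx f (Sdelta m))
      (map_mx f (Seps m)) (map_mx f (Szeta m)).

Definition sem_cov {R : realType} {p1 p2 k1 k2 : nat}
    (m : sem R p1 p2 k1 k2) : 'M[R]_(p1 + p2) :=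
  let iPsi := invmx (Psi m) in
  let S11 := Lx1 m *m Sxi m *m (Lx1 m)^T + Sdelta m in
  let S12 := Lx1 m *m Sxi m *m (Gam m)^T *m iPsi^T *m (Lx2 m)^T in
  let S22 := Lx2 m *m iPsi *m (Gam m *m Sxi m *m (Gam m)^T + Szeta m)
               *m iPsi^T *m (Lx2 m)^T + Seps m in
  block_mx S11 S12 S12^T S22.

Definition sem_admissible {R : realType} {p1 p2 k1 k2 : nat}
    (m : sem R p1 p2 k1 k2) : Prop :=
  [/\ \rank (Lx1 m) = k1,
      (* B = I - Psi has zero diagonal *)
      forall i, (1%:M - Psi m) i i = 0 & Psi m \in unitmx] /\
  [/\ psd (Sxi m), psd (Szeta m), posdef (Sdelta m) & posdef (Seps m)].

(* [inl c] is a known constant, [inr i] the i-th coordinate of theta. *)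
Definition entry_val {R : realType} {q : nat} (theta : 'rV[R]_q)
    (e : R + 'I_q) : R :=
  match e with inl c => c | inr i => theta 0 i end.

Definition sem_at {R : realType} {q p1 p2 k1 k2 : nat}
    (M : sem (R + 'I_q) p1 p2 k1 k2) (theta : 'rV[R]_q) : sem R p1 p2 k1 k2 :=
  sem_map (entry_val theta) M.

Definition occurs_in {R : realType} {q a b : nat} (i : 'I_q)
    (A : 'M[(R + 'I_q)%type]_(a, b)) : Prop := exists j l, A j l = inr i.

Definition sem_occurs {R : realType} {q p1 p2 k1 k2 : nat} (i : 'I_q)
    (M : sem (R + 'I_q) p1 p2 k1 k2) : Prop :=
  (occurs_in i (Lx1 M) \/ occurs_in i (Lx2 M) \/ occurs_in i (Gam M) \/
   occurs_in i (Psi M)) \/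
  (occurs_in i (Sxi M) \/ occurs_in i (Sdelta M) \/ occurs_in i (Seps M) \/
   occurs_in i (Szeta M)).

Definition observed {R : realType} {Omega : Type} {p1 p2 k1 k2 : nat}
    (L1 : 'M[R]_(p1, k1)) (L2 : 'M[R]_(p2, k2))
    (xi : R -> Omega -> 'cV[R]_k1) (delta : R -> Omega -> 'cV[R]_p1)
    (eta : R -> Omega -> 'cV[R]_k2) (eps : R -> Omega -> 'cV[R]_p2) :
    R -> Omega -> 'cV[R]_(p1 + p2) :=
  fun t w => col_mx (L1 *m xi t w + delta t w) (L2 *m eta t w + eps t w).

Definition realized_cov {R : realType} {Omega : Type} {p : nat}
    (X : R -> Omega -> 'cV[R]_p) (h : nat -> R) (n : nat) (w : Omega) :
    'M[R]_p :=
  let dX (i : nat) := X (i.+1%:R * h n) w - X (i%:R * h n) w in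
  (n%:R * h n)^-1 *: \sum_(i < n) dX i *m (dX i)^T.

Definition Fdisc {R : realType} {p : nat} (Q S : 'M[R]_p) : R :=
  ln (\det S) - ln (\det Q) + \tr (invmx S *m Q) - p%:R.

Definition contrast {R : realType} {p : nat} (Q S : 'M[R]_p) : R :=
  if Q \in unitmx then Fdisc Q S else enorm (vech Q - vech S) ^+ 2.

Definition is_minimizer {R : realType} {T : Type} (D : set T) (f : T -> R)
    (x : T) : Prop := D x /\ forall y, D y -> f x <= f y.

(* Main.v *)
(* On the event where Q n is close to Sigma0, the contrast is bounded below by a
   constant c > 0, uniformly over Theta: (Q, theta) |-> Fdisc Q (Sigma theta) is
   continuous, Theta is compact, and Fdisc Sigma0 (Sigma theta) > 0 as soon as
   Sigma0 <> Sigma theta.  There the statistic is at least n c, which exceeds any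
   fixed quantile for n large.  It remains to see that Q n -> Sigma0 in
   probability.  An increment of the observed process is the sum of a drift part
   with second moment O(h_n ^ 2) and of S (W_(t + h_n) - W_t), where W stacks the
   four Wiener processes and S S^T = Sigma0; the normalized squares of the noise
   part obey a law of large numbers in L2, the other terms are O(sqrt h_n) in L1. *)

Require Import Defs.
From HB Require Import structures.
From mathcomp Require Import finmap.
From mathcomp Require Import all_boot all_order all_algebra.
From mathcomp Require Import all_classical all_reals all_analysis.
From mathcomp Require Import measurable_realfun ring lra.
Import Order.TTheory GRing.Theory Num.Theory.
Import numFieldNormedType.Exports.
Import HBNNSimple.
Local Open Scope classical_set_scope.
Local Open Scope ring_scope.
Set Implicit Arguments.
Unset Strict Implicit.
Unset Printing Implicit Defensive.

(** * Positivity of the discrepancy *)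

(** The drift part of an increment depends on the Wiener increment over the same interval, so the
    cross terms cannot be treated by independence, and only second moments, of order [h n ^+ 2], are
    bounded for the drift. This is why convergence is in L1: with [s = Num.sqrt (h n)], the bound
    [|D U| <= D ^+ 2 / s + s * U ^+ 2] has both terms of mean O([h n * s]), which leaves O([s])
    after averaging and division by [h n]. Independence enters only through products of at most four
    noise increments. The normal moments needed there come from two exponential identities, each of
    which restates that a normal density has total mass 1. *)

Lemma quad_scalar {R : realType} {n : nat} (M : 'M[R]_n) (A : 'M[R]_n) (v : 'cV[R]_n) :
  (v^T *m (A *m M *m A^T) *m v) 0 0 = ((A^T *m v)^T *m M *m (A^T *m v)) 0 0.
Proof. by rewrite trmx_mul trmxK !mulmxA. Qed.

Lemma posdef_congr {R : realType} {n : nat} (M A : 'M[R]_n) :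
  posdef M -> A \in unitmx -> posdef (A *m M *m A^T).
Proof.
move=> [Msym Mpos] Au; split.
  by rewrite !trmx_mul trmxK Msym mulmxA.
move=> v v0; rewrite quad_scalar; apply: Mpos.
apply: contra_neq v0 => Av0.
by rewrite -[v](@mulKmx _ _ _ A^T) ?unitmx_tr// Av0 mulmx0.
Qed.

(** Induction on the size. With first column [a], [b] and remaining block [D], the Schur complement
    [D - a^-1 *: (b *m b^T)] is again positive definite; its factor [L'] is bordered by the column
    with entries [Num.sqrt a] and [b / Num.sqrt a]. *)
Lemma cholesky {R : realType} {n : nat} (M : 'M[R]_n) : posdef M ->
  exists L : 'M[R]_n, [/\ is_trig_mx L, forall i, 0 < L i i & M = L *m L^T].
Proof.
elim: n M => [|n IH] M.
  move=> _; exists 0; split; [by apply/is_trig_mxP => -[]|by case|by apply/matrixP => -[]].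
rewrite -[n.+1]/(1 + n)%N in M *.
move=> [Msym Mpos].
pose a := M 0 0.
pose b : 'cV[R]_n := dlsubmx M.
pose D : 'M[R]_n := drsubmx M.
have ME : M = block_mx a%:M b^T b D.
  rewrite -[LHS]submxK; congr block_mx; first by rewrite [LHS]mx11_scalar !mxE !lshift0.
  by rewrite /b -[in RHS]Msym trmx_dlsub trmxK.
have Dsym : D^T = D by rewrite /D -[in RHS]Msym trmx_drsub.
have agt0 : 0 < a.
  have := Mpos (col_mx 1%:M 0); rewrite ME tr_col_mx mul_row_block mul_row_col.
  rewrite !trmx1 !mul1mx !trmx0 !mulmx0 !mul0mx !addr0 mulmx1 mxE eqxx mulr1n; apply.
  apply/eqP => /(congr1 (fun A : 'cV[R]_(1 + n) => A 0 0)); rewrite !mxE.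
  case: splitP => // j _; rewrite !mxE ord1 eqxx => /eqP; by rewrite oner_eq0.
pose l := Num.sqrt a.
have lgt0 : 0 < l by rewrite sqrtr_gt0.
have ll : l * l = a by rewrite -expr2 sqr_sqrtr// ltW.
have /IH[L' [L'trig L'pos L'E]] : posdef (D - a^-1 *: (b *m b^T)).
  split; first by rewrite linearB linearZ/= trmx_mul trmxK Dsym.
  move=> v v0.
  (* This first coordinate minimizes the form of [M] at [col_mx c v]; the minimum is the form of the
     Schur complement at [v]. *)
  pose c : 'M[R]_1 := - a^-1 *: (b^T *m v).
  have := Mpos (col_mx c v); rewrite ME tr_col_mx mul_row_block mul_row_col.
  have -> : (c^T *m a%:M + v^T *m b) *m c + (c^T *m b^T + v^T *m D) *m v =
      v^T *m (D - a^-1 *: (b *m b^T)) *m v.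
    have -> : c^T = - a^-1 *: (v^T *m b).
      by apply/matrixP => i j; rewrite !mxE; congr (_ * _);
        apply: eq_bigr => k _; rewrite !mxE mulrC.
    rewrite /c mul_mx_scalar scalerA mulrN divff ?gt_eqF//.
    rewrite scaleN1r addNr mul0mx add0r mulmxBr.
    by rewrite -scalemxAl scaleNr addrC -scalemxAr mulmxA.
  apply; apply: contra_neq v0 => cv0.
  by rewrite -(col_mxKd c v) cv0 linear0.
exists (block_mx l%:M 0 (l^-1 *: b) L'); split.
- by rewrite is_trig_block_mx// eqxx L'trig andbT scalar_mx_is_trig.
- move=> i; case: (split_ordP i) => j ->.
    by rewrite block_mxEul mxE eqxx mulr1n.
  by rewrite block_mxEdr.
rewrite ME tr_block_mx mulmx_block !tr_scalar_mx !trmx0 !mulmx0 !mul0mx !addr0.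
rewrite -L'E linearZ/= -!scalemxAr -!scalemxAl !scalerA; congr block_mx.
- by rewrite -scalar_mxM ll.
- by rewrite mul_scalar_mx scalerA mulVf ?gt_eqF// scale1r.
- by rewrite mul_mx_scalar scalerA mulVf ?gt_eqF// scale1r.
- by rewrite -invfM ll addrC subrK.
Qed.

Lemma posdef_det_gt0 {R : realType} {n : nat} (M : 'M[R]_n) : posdef M -> 0 < \det M.
Proof.
move=> /cholesky[L [Ltrig Lpos ->]].
by rewrite det_mulmx det_tr det_trig// mulr_gt0// prodr_gt0.
Qed.

Lemma lt_ln_sub1 {R : realType} (x : R) : 0 < x -> x != 1 -> ln x < x - 1.
Proof.
move=> x0 x1; have := @expR_gt1Dx R (ln x).
rewrite lnK ?posrE// ltrBrDl; apply.
by rewrite ln_eq0.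
Qed.

(* With S = L L^T and L^-1 Q L^-T = K K^T, K lower triangular with positive
   diagonal, Fdisc Q S is the sum of the K i i ^+ 2 - 1 - ln (K i i ^+ 2) and of
   the squares of the off-diagonal entries of K. *)
Lemma Fdisc_gt0 {R : realType} {n : nat} (Q S : 'M[R]_n) :
  posdef Q -> posdef S -> Q <> S -> 0 < Fdisc Q S.
Proof.
move=> Qpd Spd QS.
have [L [Ltrig Lpos SE]] := cholesky Spd.
have Lu : L \in unitmx by rewrite unitmxE det_trig// unitfE gt_eqF// prodr_gt0.
have LVu : invmx L \in unitmx by rewrite unitmx_inv.
have [K [Ktrig Kpos KE]] := cholesky (posdef_congr Qpd LVu).
have QE : Q = L *m (K *m K^T) *m L^T.
  rewrite -KE !mulmxA mulmxV// mul1mx -mulmxA -trmx_mul mulmxV//.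
  by rewrite trmx1 mulmx1.
have Kdet : 0 < \prod_i K i i by rewrite prodr_gt0.
have Ldet : 0 < \prod_i L i i by rewrite prodr_gt0.
have trE : \tr (invmx S *m Q) = \sum_i \sum_j K i j ^+ 2.
  have -> : invmx S *m Q = (invmx L)^T *m (K *m K^T) *m L^T.
    have Su : S \in unitmx by rewrite SE unitmx_mul unitmx_tr Lu.
    apply: (can_inj (mulKmx Su)); rewrite mulKVmx// QE SE !mulmxA.
    by rewrite trmx_inv mulmxK ?unitmx_tr.
  rewrite mxtrace_mulC mulmxA -trmx_mul mulVmx// trmx1 mul1mx.
  by apply: eq_bigr => i _; rewrite mxE; apply: eq_bigr => j _; rewrite mxE expr2.
have lnE : ln (\det S) - ln (\det Q) = - \sum_i ln (K i i ^+ 2).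
  rewrite QE SE !det_mulmx !det_tr (det_trig Ltrig) (det_trig Ktrig).
  set x := \prod_i L i i; set y := \prod_i K i i.
  have -> : x * (y * y) * x = (x * x) * (y * y) by ring.
  rewrite (lnM (x := x * x)) ?posrE ?mulr_gt0// opprD addrA subrr add0r -expr2.
  congr (- _); rewrite /y -prodrXl.
  suff : 0 < \prod_i K i i ^+ 2 /\ ln (\prod_i K i i ^+ 2) = \sum_i ln (K i i ^+ 2) by case.
  elim/big_rec2 : _ => [|i a b _ [b0 bE]]; first by rewrite ln1.
  by rewrite -bE lnM ?posrE ?exprn_gt0// mulr_gt0// exprn_gt0.
have {}lnE : Fdisc Q S = \sum_i ((K i i ^+ 2 - 1 - ln (K i i ^+ 2))
                         + \sum_(j | j != i) K i j ^+ 2).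
  rewrite /Fdisc lnE trE -[n in n%:R]card_ord -sum1_card natr_sum -!sumrN -!big_split/=.
  apply: eq_bigr => i _; rewrite (bigD1 i)//=; ring.
have diag_ge0 i : 0 <= K i i ^+ 2 - 1 - ln (K i i ^+ 2).
  rewrite subr_ge0; have [->|K1] := eqVneq (K i i ^+ 2) 1; first by rewrite ln1 subrr.
  by rewrite ltW// lt_ln_sub1// exprn_gt0.
(* If this sum of nonnegative terms vanished, every term would. Strictness of [ln x < x - 1] away
   from 1 then forces [K = 1%:M], hence [Q = S]. *)
rewrite lnE lt_neqAle eq_sym psumr_eq0; last first.
  by move=> i _; rewrite addr_ge0// sumr_ge0// => j _; rewrite sqr_ge0.
rewrite sumr_ge0 ?andbT; last first.
  by move=> i _; rewrite addr_ge0// sumr_ge0// => j _; rewrite sqr_ge0.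
apply/negP => /allP K0; apply: QS; rewrite QE SE.
suff -> : K = 1%:M by rewrite trmx1 mulmx1 mulmx1.
apply/matrixP => i j; have := K0 i (mem_index_enum _).
rewrite paddr_eq0//; last by rewrite sumr_ge0// => k _; rewrite sqr_ge0.
move=> /andP[diag0 off0]; rewrite mxE.
case: (eqVneq i j) => [<-|ij] /=.
  have [K1|K1] := eqVneq (K i i ^+ 2) 1.
    by apply/eqP; rewrite -(eqrXn2 (n := 2)) ?expr1n ?K1 ?ltW.
  by have := lt_ln_sub1 (exprn_gt0 2 (Kpos i)) K1; rewrite -subr_gt0 (eqP diag0) ltxx.
move: off0; rewrite psumr_eq0; last by move=> k _; rewrite sqr_ge0.
move=> /allP/(_ j (mem_index_enum _)); rewrite eq_sym ij /= sqrf_eq0 => /eqP ->//.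
Qed.

(** * Positive definiteness of the model covariance *)

Definition load_xi {R : realType} {p1 p2 k1 k2 : nat} (m : sem R p1 p2 k1 k2) :
    'M[R]_(p1 + p2, k1) :=
  col_mx (Lx1 m) (Lx2 m *m invmx (Psi m) *m Gam m).

Definition load_zeta {R : realType} {p1 p2 k1 k2 : nat} (m : sem R p1 p2 k1 k2) :
    'M[R]_(p1 + p2, k2) :=
  col_mx 0 (Lx2 m *m invmx (Psi m)).

(** Solving the structural equation for eta makes the observed vector a linear image of the four
    latent ones, with loadings [load_xi], [load_zeta] and identity blocks; the covariance is then a
    sum of congruences. Symmetry of [Sxi] identifies the lower left block, which [sem_cov] gives as
    a transpose. *)
Lemma sem_covE {R : realType} {p1 p2 k1 k2 : nat} (m : sem R p1 p2 k1 k2) :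
  (Sxi m)^T = Sxi m ->
  sem_cov m = load_xi m *m Sxi m *m (load_xi m)^T
            + block_mx (Sdelta m) 0 0 (Seps m)
            + load_zeta m *m Szeta m *m (load_zeta m)^T.
Proof.
move=> Sxi_sym; rewrite /sem_cov /load_xi /load_zeta.
rewrite !mul_col_mx !tr_col_mx !mul_mx_row -!/(block_mx _ _ _ _)
  !trmx0 !mul0mx !mulmx0 !add_block_mx.
rewrite !addr0 !trmx_mul !trmxK Sxi_sym; congr block_mx; rewrite !mulmxA//.
by rewrite mulmxDr !mulmxDl !mulmxA addrAC.
Qed.

Lemma psd_quad_congr {R : realType} {n k : nat} (M : 'M[R]_k) (A : 'M[R]_(n, k))
    (v : 'cV[R]_n) : psd M -> 0 <= (v^T *m (A *m M *m A^T) *m v) 0 0.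
Proof.
move=> [_ Mge0]; have := Mge0 (A^T *m v).
by rewrite trmx_mul trmxK !mulmxA.
Qed.

(** The block diagonal of the two error covariances is positive definite by itself; the two factor
    terms are congruences of positive semidefinite matrices and can only add to the form. *)
Lemma sem_cov_posdef {R : realType} {p1 p2 k1 k2 : nat} (m : sem R p1 p2 k1 k2) :
  psd (Sxi m) -> psd (Szeta m) -> posdef (Sdelta m) -> posdef (Seps m) ->
  posdef (sem_cov m).
Proof.
move=> Sxi_psd Szeta_psd [Sd_sym Sd_pos] [Se_sym Se_pos].
rewrite sem_covE; last by case: Sxi_psd.
have [Sxi_sym _] := Sxi_psd; have [Szeta_sym _] := Szeta_psd.
split.
  rewrite !linearD/= !trmx_mul !trmxK Sxi_sym Szeta_sym !mulmxA tr_block_mx.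
  by rewrite !trmx0 Sd_sym Se_sym.
have mxD (A B : 'M[R]_1) : (A + B) 0 0 = A 0 0 + B 0 0 by rewrite mxE.
move=> v v0; rewrite !mulmxDr !mulmxDl !mxD.
rewrite ltr_wpDr ?psd_quad_congr// ltr_wpDl ?psd_quad_congr//.
rewrite -[v]vsubmxK in v0 *; set x := usubmx v; set y := dsubmx v in v0 *.
rewrite tr_col_mx mul_row_block mul_row_col !mulmx0 addr0 add0r mxD.
have Sd_ge0 (z : 'cV[R]_p1) : 0 <= (z^T *m Sdelta m *m z) 0 0.
  have [->|/Sd_pos/ltW//] := eqVneq z 0; by rewrite mulmx0 mxE.
have Se_ge0 (z : 'cV[R]_p2) : 0 <= (z^T *m Seps m *m z) 0 0.
  have [->|/Se_pos/ltW//] := eqVneq z 0; by rewrite mulmx0 mxE.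
have [x0|x0] := eqVneq x 0; last by rewrite ltr_wpDr// Sd_pos.
rewrite ltr_wpDl// Se_pos//; apply: contra_neq v0 => y0.
by rewrite -/x -/y x0 y0 col_mx0.
Qed.

(** * Continuity and measurability of the contrast *)

(* A class of real functions on T, closed under the operations that build
   Fdisc \o sem_cov; side conditions only have to hold along the filter F.  It
   is instantiated with continuity at x (F the neighbourhoods of x) and with
   measurability (F the trivial filter). *)
Record function_algebra {R : realType} {T : Type} (F : set_system T)
    (C : (T -> R) -> Prop) : Prop := FunctionAlgebra {
  fa_cst : forall c, C (fun=> c) ;
  fa_add : forall f g, C f -> C g -> C (fun t => f t + g t) ;
  fa_mul : forall f g, C f -> C g -> C (fun t => f t * g t) ;
  fa_inv : forall f, C f -> (\forall t \near F, f t != 0) ->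
    C (fun t => (f t)^-1) ;
  fa_near : forall f g, (\forall t \near F, f t = g t) -> C f -> C g }.

Definition mx_in {R : realType} {T : Type} (C : (T -> R) -> Prop) {m n : nat}
    (A : T -> 'M[R]_(m, n)) : Prop := forall i j, C (fun t => A t i j).

Lemma fa_sum {R : realType} {T : Type} {F : set_system T} {C : (T -> R) -> Prop}
    (I : Type) (r : seq I) (Pr : pred I) (f : I -> T -> R) :
  function_algebra F C -> (forall i, Pr i -> C (f i)) ->
  C (fun t => \sum_(i <- r | Pr i) f i t).
Proof.
move=> FC Cf; elim: r => [|i r IH].
  by have := fa_cst FC 0; congr C; apply/funext => t; rewrite big_nil.
case: (boolP (Pr i)) => Pi.
  have := fa_add FC (Cf i Pi) IH.
  by congr C; apply/funext => t; rewrite big_cons Pi.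
by have := IH; congr C; apply/funext => t; rewrite big_cons (negbTE Pi).
Qed.

Lemma fa_prod {R : realType} {T : Type} {F : set_system T} {C : (T -> R) -> Prop}
    (I : Type) (r : seq I) (Pr : pred I) (f : I -> T -> R) :
  function_algebra F C -> (forall i, Pr i -> C (f i)) ->
  C (fun t => \prod_(i <- r | Pr i) f i t).
Proof.
move=> FC Cf; elim: r => [|i r IH].
  by have := fa_cst FC 1; congr C; apply/funext => t; rewrite big_nil.
case: (boolP (Pr i)) => Pi.
  have := fa_mul FC (Cf i Pi) IH.
  by congr C; apply/funext => t; rewrite big_cons Pi.
by have := IH; congr C; apply/funext => t; rewrite big_cons (negbTE Pi).
Qed.

Lemma fa_opp {R : realType} {T : Type} {F : set_system T} {C : (T -> R) -> Prop}
  (f : T -> R) : function_algebra F C -> C f -> C (fun t => - f t).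
Proof.
move=> FC Cf; have := fa_mul FC (fa_cst FC (-1)) Cf.
by congr C; apply/funext => t; rewrite mulN1r.
Qed.

Lemma mx_in_mul {R : realType} {T : Type} {F : set_system T}
    {C : (T -> R) -> Prop} {m n k : nat} (A : T -> 'M[R]_(m, n))
    (B : T -> 'M[R]_(n, k)) :
  function_algebra F C -> mx_in C A -> mx_in C B -> mx_in C (fun t => A t *m B t).
Proof.
move=> FC CA CB i j; have : C (fun t => \sum_l A t i l * B t l j).
  by apply: (fa_sum _ FC) => l _; apply: (fa_mul FC).
by congr C; apply/funext => t; rewrite mxE.
Qed.

Lemma mx_in_add {R : realType} {T : Type} {F : set_system T}
    {C : (T -> R) -> Prop} {m n : nat} (A B : T -> 'M[R]_(m, n)) :
  function_algebra F C -> mx_in C A -> mx_in C B -> mx_in C (fun t => A t + B t).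
Proof.
move=> FC CA CB i j; have := fa_add FC (CA i j) (CB i j).
by congr C; apply/funext => t; rewrite mxE.
Qed.

Lemma mx_in_tr {R : realType} {T : Type} {C : (T -> R) -> Prop} {m n : nat}
    (A : T -> 'M[R]_(m, n)) : mx_in C A -> mx_in C (fun t => (A t)^T).
Proof.
by move=> CA i j; have := CA j i; congr C; apply/funext => t; rewrite mxE.
Qed.

Lemma mx_in_block {R : realType} {T : Type} {C : (T -> R) -> Prop}
    {m1 m2 n1 n2 : nat} (A : T -> 'M[R]_(m1, n1)) (B : T -> 'M[R]_(m1, n2))
    (D : T -> 'M[R]_(m2, n1)) (E : T -> 'M[R]_(m2, n2)) :
  mx_in C A -> mx_in C B -> mx_in C D -> mx_in C E ->
  mx_in C (fun t => block_mx (A t) (B t) (D t) (E t)).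
Proof.
move=> CA CB CD CE i j.
by case: (split_ordP i) => i' ->; case: (split_ordP j) => j' ->;
  [have := CA i' j'|have := CB i' j'|have := CD i' j'|have := CE i' j'];
  congr C; apply/funext => t;
  rewrite ?block_mxEul ?block_mxEur ?block_mxEdl ?block_mxEdr.
Qed.

Lemma mx_in_det {R : realType} {T : Type} {F : set_system T}
    {C : (T -> R) -> Prop} {n : nat} (A : T -> 'M[R]_n) :
  function_algebra F C -> mx_in C A -> C (fun t => \det (A t)).
Proof.
move=> FC CA; apply: (fa_sum _ FC) => s _; apply: (fa_mul FC).
  exact: (fa_cst FC).
by apply: (fa_prod _ FC) => i _; exact: CA.
Qed.

(** Off the units [invmx A] is [A] itself by default, so Cramer's formula holds only along [F];
    closure under [fa_near] absorbs the difference. *)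
Lemma mx_in_inv {R : realType} {T : Type} {F : set_system T} {FF : Filter F}
    {C : (T -> R) -> Prop} {n : nat} (A : T -> 'M[R]_n) :
  function_algebra F C -> mx_in C A -> (\forall t \near F, A t \in unitmx) ->
  mx_in C (fun t => invmx (A t)).
Proof.
move=> FC CA Au i j.
apply: (fa_near FC (f := fun t => (\det (A t))^-1 * \adj (A t) i j)).
  by apply: filterS Au => t Atu; rewrite /invmx Atu [RHS]mxE.
apply: (fa_mul FC).
  apply: (fa_inv FC); first exact: mx_in_det FC CA.
  by apply: filterS Au => t; rewrite unitmxE unitfE.
have : C (fun t => (-1) ^+ (j + i) * \det (row' j (col' i (A t)))).
  apply: (fa_mul FC); first exact: (fa_cst FC).
  apply: (mx_in_det FC) => a b.
  by have := CA (lift j a) (lift i b); congr C; apply/funext => t; rewrite !mxE.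
by congr C; apply/funext => t; rewrite mxE.
Qed.

(** Membership of the logarithms is an assumption because it is obtained differently in the two
    instances: continuity of [ln] needs a positive determinant at the point, measurability holds
    everywhere. *)
Lemma fa_Fdisc {R : realType} {T : Type} {F : set_system T} {FF : Filter F}
    {C : (T -> R) -> Prop} {n : nat} (Q S : T -> 'M[R]_n) :
  function_algebra F C -> mx_in C Q -> mx_in C S ->
  (\forall t \near F, S t \in unitmx) ->
  C (fun t => ln (\det (Q t))) -> C (fun t => ln (\det (S t))) ->
  C (fun t => Fdisc (Q t) (S t)).
Proof.
move=> FC CQ CS Su ClQ ClS; apply: (fa_add FC); last exact: (fa_cst FC).
apply: (fa_add FC); first by apply: (fa_add FC) => //; exact: (fa_opp FC).
by apply: (fa_sum _ FC) => i _; apply: (mx_in_mul FC) => //; exact: (mx_in_inv FC).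
Qed.

Lemma mx_in_entries {R : realType} {T : Type} {F : set_system T}
    {C : (T -> R) -> Prop} {q m n : nat} (A : 'M[(R + 'I_q)%type]_(m, n))
    (theta : T -> 'rV[R]_q) :
  function_algebra F C -> mx_in C theta ->
  mx_in C (fun t => map_mx (entry_val (theta t)) A).
Proof.
move=> FC Ctheta i j; case E : (A i j) => [c|l].
  by have := fa_cst FC c; congr C; apply/funext => t; rewrite mxE E.
by have := Ctheta 0 l; congr C; apply/funext => t; rewrite mxE E.
Qed.

Lemma fa_sem_cov {R : realType} {T : Type} {F : set_system T} {FF : Filter F}
    {C : (T -> R) -> Prop} {q p1 p2 k1 k2 : nat} (M : sem (R + 'I_q) p1 p2 k1 k2)
    (theta : T -> 'rV[R]_q) :
  function_algebra F C -> mx_in C theta ->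
  (\forall t \near F, Psi (sem_at M (theta t)) \in unitmx) ->
  mx_in C (fun t => sem_cov (sem_at M (theta t))).
Proof.
move=> FC Ctheta Psiu.
have Centry m n (A : 'M[(R + 'I_q)%type]_(m, n)) := mx_in_entries A FC Ctheta.
have CPsi : mx_in C (fun t => invmx (Psi (sem_at M (theta t)))).
  exact: (mx_in_inv FC (Centry _ _ (Psi M)) Psiu).
have C12 : mx_in C (fun t => Lx1 (sem_at M (theta t)) *m Sxi (sem_at M (theta t))
    *m (Gam (sem_at M (theta t)))^T *m (invmx (Psi (sem_at M (theta t))))^T
    *m (Lx2 (sem_at M (theta t)))^T).
  by do ![apply: (mx_in_mul FC)|apply: mx_in_tr];
    first [exact: Centry|exact: CPsi].
apply: mx_in_block => //; last 1 first.
- by do ![apply: (mx_in_add FC)|apply: (mx_in_mul FC)|apply: mx_in_tr];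
    first [exact: Centry|exact: CPsi].
- by do ![apply: (mx_in_add FC)|apply: (mx_in_mul FC)|apply: mx_in_tr];
    first [exact: Centry|exact: CPsi].
- exact: mx_in_tr.
Qed.

Lemma function_algebra_continuous {R : realType} {T : topologicalType} (x : T) :
  function_algebra (nbhs x) (fun f : T -> R => {for x, continuous f}).
Proof.
split.
- by move=> c; exact: cvg_cst.
- by move=> f g Cf Cg; exact: cvgD.
- by move=> f g Cf Cg; exact: cvgM.
- by move=> f Cf f0; apply: cvgV => //; exact: (nbhs_singleton f0).
- move=> f g fg Cf; rewrite /prop_for /continuous_at -(nbhs_singleton fg).
  apply: cvg_trans Cf; apply: near_eq_cvg; exact: fg.
Qed.

Lemma function_algebra_measurable {R : realType} {d : measure_display}
    {T : measurableType d} :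
  function_algebra (globally [set: T]) (fun f : T -> R => measurable_fun setT f).
Proof.
split.
- by move=> c; exact: measurable_cst.
- by move=> f g Cf Cg; exact: measurable_funD.
- by move=> f g Cf Cg; exact: measurable_funM.
- move=> f Cf _.
  (* x^-1 = x * (x ^ 2) `^ (-1), also at 0 *)
  have -> : (fun t => (f t)^-1) = (fun t => f t * (f t ^+ 2) `^ (-1)).
    apply/funext => t; rewrite powR_inv1 ?sqr_ge0//.
    by have [->|f0] := eqVneq (f t) 0; rewrite ?invr0 ?mul0r// expr2 invfM mulVKf.
  apply: measurable_funM => //.
  by apply: measurableT_comp (measurable_powR _) _; exact: measurable_funX.
- by move=> f g fg; congr measurable_fun; apply/funext => t; exact: fg.
Qed.

(** Compactness is used in its near-covering form: the strict inequality persists near each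
    [(theta, (Sigma0, 0))], hence for all [theta] at once near [(Sigma0, 0)]. The threshold is a
    variable with limit 0, so that one neighbourhood supplies both the radius [e] and the constant
    [c]. *)
Lemma contrast_bounded_below {R : realType} {q p1 p2 k1 k2 : nat}
    (M : sem (R + 'I_q) p1 p2 k1 k2) (Theta : set 'rV[R]_q)
    (Sigma0 : 'M[R]_(p1 + p2)) :
  compact Theta -> (forall theta, Theta theta -> sem_admissible (sem_at M theta)) ->
  posdef Sigma0 -> (forall theta, Theta theta -> Sigma0 <> sem_cov (sem_at M theta)) ->
  exists e : R, 0 < e /\ exists c : R, 0 < c /\
    forall Q : 'M[R]_(p1 + p2), (forall i j, `|Q i j - Sigma0 i j| < e) ->
    forall theta, Theta theta -> c < contrast Q (sem_cov (sem_at M theta)).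
Proof.
move=> Thetac adm S0pd H1.
pose z0 : 'M[R]_(p1 + p2) * R := (Sigma0, 0).
have : \forall z \near z0, Theta `<=`
    (fun theta => z.2 < contrast z.1 (sem_cov (sem_at M theta))).
  apply: ((iffLR (compact_near_coveringP Theta)) Thetac _ (nbhs z0)
    (fun z theta => z.2 < contrast z.1 (sem_cov (sem_at M theta)))) => theta Th.
  have [[_ _ Psiu] [xi_psd zeta_psd d_pd e_pd]] := adm _ Th.
  have Spd := sem_cov_posdef xi_psd zeta_psd d_pd e_pd.
  pose T : topologicalType := ('rV[R]_q * ('M[R]_(p1 + p2) * R))%type.
  pose x0 : T := (theta, z0).
  have FC := @function_algebra_continuous R T x0.
  pose C (f : T -> R) := {for x0, continuous f}.
  have Cth : mx_in C (fun x : T => x.1).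
    move=> i j; apply: (@continuous_comp _ _ _ fst (fun A : 'rV[R]_q => A i j)).
      exact: cvg_fst.
    exact: coord_continuous.
  have CQ : mx_in C (fun x : T => x.2.1).
    move=> i j; apply: (@continuous_comp _ _ _ (fun x : T => x.2.1)
      (fun A : 'M[R]_(p1 + p2) => A i j)); last exact: coord_continuous.
    apply: (@continuous_comp _ _ _ snd fst); first exact: cvg_snd.
    exact: cvg_fst.
  have Cc : C (fun x : T => x.2.2).
    by apply: (@continuous_comp _ _ _ snd snd); exact: cvg_snd.
  have near_gt0 (f : T -> R) : C f -> 0 < f x0 -> \forall x \near x0, 0 < f x.
    by move=> Cf f0; exact: (@cvgr_gt _ _ _ _ f (f x0) Cf 0 f0).
  have near_neq0 (f : T -> R) : C f -> f x0 != 0 -> \forall x \near x0, f x != 0.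
    by move=> Cf f0; exact: (@cvgr_neq0 _ _ _ _ _ f (f x0) Cf f0).
  have Cln (f : T -> R) : C f -> 0 < f x0 -> C (fun x => ln (f x)).
    by move=> Cf f0; apply: (@continuous_comp _ _ _ f (@ln R)) => //; exact: continuous_ln.
  have CSigma : mx_in C (fun x : T => sem_cov (sem_at M x.1)).
    have CPsi : mx_in C (fun x : T => Psi (sem_at M x.1)).
      exact: (mx_in_entries (Psi M) FC Cth).
    apply: (fa_sem_cov FC) => //.
    have := near_neq0 _ (mx_in_det FC CPsi).
    rewrite -unitfE -unitmxE => /(_ Psiu).
    by apply: filterS => x; rewrite unitmxE unitfE.
  have CdetS := mx_in_det FC CSigma.
  have CdetQ := mx_in_det FC CQ.
  have Snear := near_gt0 _ CdetS (posdef_det_gt0 Spd).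
  have Qnear := near_gt0 _ CdetQ (posdef_det_gt0 S0pd).
  have CF : C (fun x : T => Fdisc x.2.1 (sem_cov (sem_at M x.1)) - x.2.2).
    apply: (fa_add FC); last exact: (fa_opp FC).
    apply: (fa_Fdisc FC) => //.
    - by apply: filterS Snear => x; rewrite unitmxE unitfE => /gt_eqF ->.
    - exact: Cln CdetQ (posdef_det_gt0 S0pd).
    - exact: Cln CdetS (posdef_det_gt0 Spd).
  have Fnear := near_gt0 _ CF.
  have {}Fnear : \forall x \near x0, 0 < Fdisc x.2.1 (sem_cov (sem_at M x.1)) - x.2.2.
    by apply: Fnear; rewrite subr0 Fdisc_gt0//; exact: H1.
  (* Near [Sigma0] the determinant of [Q] is positive, so [contrast] takes its [Fdisc] branch. *)
  apply: filterS2 Qnear Fnear => x detQ; rewrite subr_gt0 /contrast.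
  by rewrite unitmxE unitfE gt_eqF.
rewrite -nbhs_nearE => /nbhs_ballP[e /= e0 eP].
(* The threshold has to be positive and strictly inside the ball of radius [e] around 0, hence the
   half. *)
exists e; split => //; exists (e / 2); split; first by rewrite divr_gt0.
move=> Q QS theta Th; apply: (eP (Q, e / 2)) => //; split => /=.
  split => // i j; rewrite /ball/= distrC; exact: QS.
rewrite /ball/= sub0r normrN gtr0_norm ?divr_gt0// ltr_pdivrMr// mulr_natr.
by rewrite mulr2n ltrDl.
Qed.

(** * Means and independence *)

Lemma measurable_indic_comp {R : realType} {d d' : measure_display}
    {T : measurableType d} {E : measurableType d'} (X : T -> E) (A : set E) :
  measurable_fun setT X -> measurable A ->
  measurable_fun setT (fun x => \1_A (X x) : R).
Proof.
move=> mX mA; apply: (measurableT_comp (f := (\1_A : E -> R))) => //.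
Qed.

(** Simple functions, then monotone convergence. Two spaces and two weights are allowed so that the
    lemma serves twice: with [G2] a normal density on the line, and with [G1] the product of the
    other factors of an independent family against a constant [G2]. *)
Lemma weighted_law_ext {R : realType} {d1 d2 d : measure_display}
    {T1 : measurableType d1} {T2 : measurableType d2} {E : measurableType d}
    (mu1 : {measure set T1 -> \bar R}) (mu2 : {measure set T2 -> \bar R})
    (X1 : T1 -> E) (X2 : T2 -> E) (G1 : T1 -> R) (G2 : T2 -> R) :
  measurable_fun setT X1 -> measurable_fun setT X2 ->
  measurable_fun setT G1 -> measurable_fun setT G2 ->
  (forall x, 0 <= G1 x) -> (forall x, 0 <= G2 x) ->
  (forall A, measurable A ->
    \int[mu1]_x (G1 x * \1_A (X1 x))%:E = \int[mu2]_x (G2 x * \1_A (X2 x))%:E)%E ->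
  forall f : E -> R, measurable_fun setT f -> (forall y, 0 <= f y) ->
    (\int[mu1]_x (G1 x * f (X1 x))%:E = \int[mu2]_x (G2 x * f (X2 x))%:E)%E.
Proof.
move=> mX1 mX2 mG1 mG2 G10 G20 GA_eq f mf f0.
pose g := nnsfun_approx measurableT (iffRL (measurable_EFinP _ _) mf).
have gf (y : E) : (g n y)%:E @[n --> \oo] --> (f y)%:E.
  by apply: (cvg_nnsfun_approx measurableT) => // z _; rewrite /= lee_fin.
have simpleE n : exists N (r : 'I_N -> R) (A : 'I_N -> set E),
    [/\ forall i, 0 <= r i, forall i, measurable (A i) &
        forall y, g n y = \sum_(i < N) r i * \1_(A i) y].
  exists #|` fset_set (range (g n))|, (fun i => (fset_set (range (g n)))`_i).
  exists (fun i => g n @^-1` [set (fset_set (range (g n)))`_i]); split.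
  - move=> i; have : (fset_set (range (g n)))`_i \in fset_set (range (g n)).
      by rewrite mem_nth.
    by rewrite in_fset_set// => /set_mem[y _ <-].
  - by move=> i; exact: measurable_funPTI.
  - by move=> y; rewrite fimfunEord.
have simple n : (\int[mu1]_x (G1 x * g n (X1 x))%:E =
    \int[mu2]_x (G2 x * g n (X2 x))%:E)%E.
  have [N [r [A [r0 mA gE]]]] := simpleE n.
  have expand d' (T : measurableType d') (mu : {measure set T -> \bar R})
      (X : T -> E) (G : T -> R) : measurable_fun setT X -> measurable_fun setT G ->
      (forall x, 0 <= G x) ->
      (\int[mu]_x (G x * g n (X x))%:E =
       \sum_(i < N) (r i)%:E * \int[mu]_x (G x * \1_(A i) (X x))%:E)%E.
    move=> mX mG G0.
    have mGA i : measurable_fun setT (fun x => (G x * \1_(A i) (X x))%:E).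
      by apply/measurable_EFinP/measurable_funM => //; exact: measurable_indic_comp.
    have GA0 i x : (0 <= (G x * \1_(A i) (X x))%:E)%E by rewrite lee_fin mulr_ge0.
    transitivity (\int[mu]_x \sum_(i < N) (r i)%:E * (G x * \1_(A i) (X x))%:E)%E.
      apply: eq_integral => x _; rewrite gE mulr_sumr sumEFin; congr EFin.
      by apply: eq_bigr => i _; rewrite mulrCA.
    rewrite ge0_integral_sum//.
    - by apply: eq_bigr => i _; rewrite ge0_integralZl_EFin.
    - by move=> i; exact: measurable_funeM.
    - by move=> i x _; rewrite mule_ge0// lee_fin.
  by rewrite !expand//; apply: eq_bigr => i _; rewrite GA_eq.
have lim d' (T : measurableType d') (mu : {measure set T -> \bar R})
    (X : T -> E) (G : T -> R) : measurable_fun setT X -> measurable_fun setT G ->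
    (forall x, 0 <= G x) ->
    (\int[mu]_x (G x * g n (X x))%:E @[n --> \oo] --> \int[mu]_x (G x * f (X x))%:E)%E.
  move=> mX mG G0.
  have -> : (\int[mu]_x (G x * f (X x))%:E = \int[mu]_x limn (fun n => (G x * g n (X x))%:E))%E.
    apply: eq_integral => x _; apply/esym/cvg_lim => //.
    under eq_fun do rewrite EFinM.
    rewrite EFinM; apply: cvgeZl => //; exact: gf.
  apply: cvg_monotone_convergence => //.
  - move=> n; apply/measurable_EFinP/measurable_funM => //.
    exact: measurableT_comp.
  - by move=> n x _; rewrite lee_fin mulr_ge0.
  - move=> x _ m n mn; rewrite lee_fin ler_wpM2l//.
    exact/lefP/nd_nnsfun_approx.
have /cvg_lim <- // := lim _ _ mu1 X1 G1 mX1 mG1 G10.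
have /cvg_lim <- // := lim _ _ mu2 X2 G2 mX2 mG2 G20.
by under eq_fun do rewrite simple.
Qed.

(** Integrability is bundled with a real value, so that means combine in [R] without finiteness side
    conditions. *)
Definition has_mean {R : realType} {d : measure_display} {T : measurableType d}
    (P : {measure set T -> \bar R}) (f : T -> R) (c : R) : Prop :=
  P.-integrable setT (EFin \o f) /\ (\int[P]_x (f x)%:E = c%:E)%E.

Lemma has_mean_sum {R : realType} {d : measure_display} {T : measurableType d}
    (P : {measure set T -> \bar R}) (I : Type) (r : seq I) (Pr : pred I)
    (f : I -> T -> R) (c : I -> R) :
  (forall i, has_mean P (f i) (c i)) ->
  has_mean P (fun x => \sum_(i <- r | Pr i) f i x) (\sum_(i <- r | Pr i) c i).
Proof.
move=> fc; split.
  have := @integrable_sum _ _ _ P setT measurableT I r Pr (fun i => EFin \o f i)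
    (fun i _ => (fc i).1).
  by congr integrable; apply/funext => x /=; rewrite sumEFin.
under eq_integral do rewrite -sumEFin.
rewrite (integral_sum measurableT (fun i => (fc i).1)).
by rewrite -sumEFin; apply: eq_bigr => i _; case: (fc i).
Qed.

Lemma has_meanZ {R : realType} {d : measure_display} {T : measurableType d}
    (P : {measure set T -> \bar R}) (f : T -> R) (a c : R) :
  has_mean P f c -> has_mean P (fun x => a * f x) (a * c).
Proof.
move=> [fi fc]; split.
  by have := integrableZl measurableT a fi; congr integrable.
by under eq_integral do rewrite EFinM; rewrite integralZl// fc.
Qed.

Lemma has_meanD {R : realType} {d : measure_display} {T : measurableType d}
    (P : {measure set T -> \bar R}) (f g : T -> R) (a b : R) :
  has_mean P f a -> has_mean P g b -> has_mean P (fun x => f x + g x) (a + b).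
Proof.
move=> [fi fc] [gi gc]; split.
  by have := integrableD measurableT fi gi; congr integrable.
by under eq_integral do rewrite EFinD; rewrite integralD// fc gc.
Qed.

Lemma has_mean_cst {R : realType} {d : measure_display} {T : measurableType d}
    (P : probability T R) (c : R) : has_mean P (fun=> c) c.
Proof.
split; first exact: finite_measure_integrable_cst.
by rewrite integral_cst//= probability_setT mule1.
Qed.

Lemma ge0_has_mean {R : realType} {d : measure_display} {T : measurableType d}
    (P : {measure set T -> \bar R}) (f : T -> R) (c : R) :
  measurable_fun setT f -> (forall x, 0 <= f x) ->
  (\int[P]_x (f x)%:E = c%:E)%E -> has_mean P f c.
Proof.
move=> mf f0 fc; split=> //; apply/integrableP; split; first exact/measurable_EFinP.
under eq_integral do rewrite gee0_abs ?lee_fin//.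
by rewrite fc ltry.
Qed.

Lemma has_mean_indic {R : realType} {d : measure_display} {T : measurableType d}
    (P : probability T R) (A : set T) : measurable A ->
  has_mean P (\1_A : T -> R) (fine (P A)).
Proof.
move=> mA; apply: ge0_has_mean => //.
by rewrite integral_indic// setIT fineK// fin_num_measure.
Qed.

(** Independence of events is the case where all factors are indicators. The factors are then freed
    one at a time, by extending an identity from indicators of [X k] to a nonnegative function of
    [X k] while the other factors act as a weight. *)
Lemma independent_mean_prod_ge0 {R : realType} {d : measure_display}
    {T : measurableType d} (P : probability T R) {I : finType}
    (X : I -> T -> R) (g : I -> R -> R) (c : I -> R) :
  (forall i, measurable_fun setT (X i)) ->
  independent P (fun i => preimage_set_system setT (X i) measurable) ->
  (forall i, measurable_fun setT (g i)) -> (forall i x, 0 <= g i x) ->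
  (forall i, has_mean P (g i \o X i) (c i)) ->
  has_mean P (fun w => \prod_i g i (X i w)) (\prod_i c i).
Proof.
move=> mX indepX.
have mprod (f : I -> R -> R) (Pr : pred I) : (forall i, measurable_fun setT (f i)) ->
    measurable_fun setT (fun w => \prod_(i | Pr i) f i (X i w)).
  move=> mf; apply: (fa_prod _ function_algebra_measurable) => i _.
  exact: measurableT_comp.
(* The list [s] contains the factors allowed not to be indicators; [enum I] gives the full claim. *)
suff main (s : seq I) (f : I -> R -> R) (b : I -> R) :
    (forall i, measurable_fun setT (f i)) -> (forall i x, 0 <= f i x) ->
    (forall i, has_mean P (f i \o X i) (b i)) ->
    (forall i, i \notin s -> exists2 A, measurable A & f i = \1_A) ->
    (\int[P]_w (\prod_i f i (X i w))%:E = (\prod_i b i)%:E)%E.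
  move=> mg g0 gc; apply: ge0_has_mean; first exact: mprod.
    by move=> w; apply: prodr_ge0.
  by apply: (main (enum I)) => // i; rewrite mem_enum.
elim: s f b => [|k s IH] f b mf f0 fb f_indic.
  have /choice[A AP] : forall i, exists A, measurable A /\ f i = \1_A.
    by move=> i; have [//|A mA fA] := f_indic i; exists A.
  have mXA i : measurable (X i @^-1` A i).
    by rewrite -[X in measurable X]setTI; apply: mX => //; exact: (AP i).1.
  have prodE w : \prod_i f i (X i w) = \1_(\bigcap_(i in [set: I]) (X i @^-1` A i)) w.
    rewrite indicE; case: (boolP (w \in _)) => [/set_mem XA|/negP XA].
      apply: big1 => i _; rewrite (AP i).2 indicE mem_set//; exact: XA.
    have [i XAi] : exists i, ~ (X i @^-1` A i) w.
      apply: contrapT => /forallNP XA'; apply: XA; rewrite inE => i _.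
      by apply: contrapT; exact: XA'.
    by rewrite (bigD1 i)//= (AP i).2 indicE memNset// mul0r.
  under eq_integral do rewrite prodE.
  rewrite integral_indic//; last exact: fin_bigcap_measurable.
  rewrite setIT; transitivity (\prod_i P (X i @^-1` A i))%E.
    apply: indepX => i.
    by exists (A i); [exact: (AP i).1|rewrite setTI].
  have PE i : P (X i @^-1` A i) = (b i)%:E.
    transitivity ((fine (P (X i @^-1` A i)))%:E); first by rewrite fineK// fin_num_measure.
    rewrite -(has_mean_indic P (mXA i)).2 -(fb i).2.
    by apply: eq_integral => w _; rewrite /= (AP i).2 !indicE.
  rewrite (eq_bigr _ (fun i _ => PE i)).
  by elim/big_rec2 : _ => // i x y _ ->.
have [ks|ks] := boolP (k \in s).
  by apply: IH => // i ins; apply: f_indic; rewrite inE negb_or ins andbT;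
    apply: contraNneq ins => ->.
pose G w := \prod_(i | i != k) f i (X i w).
have G0 w : 0 <= G w by apply: prodr_ge0.
pose C := \prod_(i | i != k) b i.
have b0 i : 0 <= b i.
  by rewrite -lee_fin -(fb i).2; apply: integral_ge0 => w _; rewrite lee_fin /=.
have C0 : 0 <= C by apply: prodr_ge0.
(* With [f k] replaced by the indicator of [A] the induction hypothesis applies, and says that under
   the weight [G] the variable [X k] has [C] times its own law. *)
have step A : measurable A ->
    (\int[P]_w (G w * \1_A (X k w))%:E = \int[P]_w (C * \1_A (X k w))%:E)%E.
  move=> mA; have mXA : measurable (X k @^-1` A).
    by rewrite -[X in measurable X]setTI; exact: mX.
  pose f' i := if i == k then \1_A else f i.
  pose b' i := if i == k then fine (P (X k @^-1` A)) else b i.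
  have [_ ->] := has_meanZ C (has_mean_indic P mXA).
  have -> : C * fine (P (X k @^-1` A)) = \prod_i b' i.
    rewrite mulrC (bigD1 k)//= /b' eqxx; congr (_ * _).
    by apply: eq_bigr => i /negbTE ->.
  rewrite -(IH f' b').
  - apply: eq_integral => w _; rewrite mulrC [in RHS](bigD1 k)//= {1}/f' eqxx.
    by congr (_ * _)%:E; apply: eq_bigr => i /negbTE ik; rewrite /f' ik.
  - by move=> i; rewrite /f'; case: eqP.
  - by move=> i x; rewrite /f'; case: eqP.
  - move=> i; rewrite /f' /b'; case: eqP => [->|_]; last exact: fb.
    exact: has_mean_indic.
  - move=> i ins; rewrite /f'; case: eqP => [_|/eqP ik]; first by exists A.
    by apply: f_indic; rewrite inE negb_or ik.
have := weighted_law_ext (mX k) (mX k) (mprod f (fun i => i != k) mf)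
  (measurable_cst C) G0 (fun=> C0) step (mf k) (f0 k).
rewrite (has_meanZ C (fb k)).2.
rewrite (bigD1 k)//= mulrC => <-.
by apply: eq_integral => w _; rewrite (bigD1 k)//= mulrC.
Qed.

Lemma has_mean_inj {R : realType} {d : measure_display} {T : measurableType d}
    (P : {measure set T -> \bar R}) (f : T -> R) (a b : R) :
  has_mean P f a -> has_mean P f b -> a = b.
Proof. by move=> [_ fa] [_]; rewrite fa => -[]. Qed.

Lemma has_mean_le {R : realType} {d : measure_display} {T : measurableType d}
    (P : {measure set T -> \bar R}) (f g : T -> R) (a b : R) :
  has_mean P f a -> has_mean P g b -> (forall x, f x <= g x) -> a <= b.
Proof.
move=> [fi fa] [gi gb] fg; rewrite -lee_fin -fa -gb.
by apply: le_integral => // x _; rewrite lee_fin.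
Qed.

Lemma has_mean_dominated {R : realType} {d : measure_display}
    {T : measurableType d} (P : {measure set T -> \bar R}) (f g : T -> R) (b : R) :
  measurable_fun setT f -> has_mean P g b -> (forall x, `|f x| <= g x) ->
  exists a, has_mean P f a.
Proof.
move=> mf [gi gb] fg.
have fi : P.-integrable setT (EFin \o f).
  apply: le_integrable gi => //; first exact/measurable_EFinP.
  by move=> x _; rewrite /= lee_fin (le_trans (fg x))// ler_norm.
exists (fine (\int[P]_x (f x)%:E)%E); split=> //.
by rewrite fineK//; exact: integrable_fin_num.
Qed.

(** Each factor is split into its positive and negative parts and the product is expanded over all
    choices [F] of parts; every summand falls under the nonnegative case. *)
Lemma independent_mean_prod {R : realType} {d : measure_display}
    {T : measurableType d} (P : probability T R) {I : finType}
    (X : I -> T -> R) (g : I -> R -> R) (c : I -> R) :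
  (forall i, measurable_fun setT (X i)) ->
  independent P (fun i => preimage_set_system setT (X i) measurable) ->
  (forall i, measurable_fun setT (g i)) ->
  (forall i, has_mean P (g i \o X i) (c i)) ->
  has_mean P (fun w => \prod_i g i (X i w)) (\prod_i c i).
Proof.
move=> mX indepX mg gc.
pose sgn (b : bool) : R := if b then 1 else -1.
pose part i b x := Num.max (sgn b * g i x) 0.
have partE i x : g i x = \sum_b sgn b * part i b x.
  rewrite big_bool /part /sgn /= !mul1r !mulN1r !maxEle.
  by case: (leP (g i x) 0) => ?; case: (leP (- g i x) 0) => ?; lra.
have mpart i b : measurable_fun setT (part i b).
  by apply: measurable_maxr => //; exact: measurable_funM.
have /choice[cp cpE] : forall ib : I * bool, exists a,
    has_mean P (part ib.1 ib.2 \o X ib.1) a.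
  move=> [i b] /=; have [gi gic] := gc i.
  have gabs : has_mean P (fun w => `|g i (X i w)|) (fine (\int[P]_w `|g i (X i w)|%:E)%E).
    split; first by have := integrable_abse gi; congr integrable.
    by rewrite fineK//; apply: integrable_fin_num => //; have := integrable_abse gi; congr integrable.
  apply: has_mean_dominated gabs _.
    exact: measurableT_comp.
  move=> w; rewrite /= /part ger0_norm ?le_max ?lexx ?orbT// ge_max normr_ge0 andbT.
  by rewrite /sgn; case: (b); rewrite ?mul1r ?mulN1r ?ler_norm// -normrN ler_norm.
have cE i : c i = \sum_b sgn b * cp (i, b).
  apply: has_mean_inj (gc i) _.
  have := has_mean_sum (index_enum bool) predT (fun b => has_meanZ (sgn b) (cpE (i, b))).
  by congr has_mean; apply/funext => w; rewrite /= partE.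
rewrite (eq_bigr _ (fun i _ => cE i)) bigA_distr_bigA /=.
have -> : (fun w => \prod_i g i (X i w)) = (fun w => \sum_(F : {ffun I -> bool})
    (\prod_i sgn (F i)) * \prod_i part i (F i) (X i w)).
  apply/funext => w; under eq_bigr do rewrite partE.
  by rewrite bigA_distr_bigA; apply: eq_bigr => F _; rewrite big_split.
apply: has_mean_sum => F; rewrite big_split; apply: has_meanZ.
apply: (independent_mean_prod_ge0 (g := fun i => part i (F i))) => //.
- by move=> i x; rewrite /part le_max lexx orbT.
- by move=> i; exact: (cpE (i, F i)).
Qed.

(** * Moments of a centered normal law *)

Lemma normal_law_mean {R : realType} {d : measure_display} {T : measurableType d}
    (P : probability T R) (U : T -> R) (s : R) (f : R -> R) (c : R) :
  measurable_fun setT U ->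
  (forall A, measurable A -> P (U @^-1` A) = normal_prob 0 s A) ->
  measurable_fun setT f -> (forall x, 0 <= f x) ->
  (\int[lebesgue_measure]_x (normal_pdf 0 s x * f x)%:E = c%:E)%E ->
  has_mean P (f \o U) c.
Proof.
move=> mU lawU mf f0 fc; apply: ge0_has_mean; [exact: measurableT_comp|by move=> x; exact: f0|].
have := @weighted_law_ext _ _ _ _ _ _ _ P (@lebesgue_measure R) U id (fun=> 1)
  (normal_pdf 0 s) mU (@measurable_id _ _ setT) (measurable_cst _)
  (measurable_normal_pdf 0 s) (fun=> ler01) (normal_pdf_ge0 0 s).
move=> /(_ _ f mf f0); rewrite fc => <-.
  by apply: eq_integral => x _; rewrite mul1r.
move=> A mA; have mUA : measurable (U @^-1` A).
  by rewrite -[X in measurable X]setTI; exact: mU.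
transitivity (P (U @^-1` A)).
  rewrite -[in RHS](setIT (U @^-1` A)) -integral_indic//.
  by apply: eq_integral => x _; rewrite mul1r.
rewrite lawU// /normal_prob [in LHS]integral_mkcond.
apply: eq_integral => x _; rewrite patchE indicE.
by case: ifP => xA; rewrite ?mulr1 ?mulr0.
Qed.

(** The integrand is the density of the normal law of mean [m] relative to that of mean 0, so its
    mean is a total mass. *)
Lemma normal_law_exp_shift {R : realType} {d : measure_display} {T : measurableType d}
    (P : probability T R) (U : T -> R) (s m : R) :
  0 < s -> measurable_fun setT U ->
  (forall A, measurable A -> P (U @^-1` A) = normal_prob 0 s A) ->
  has_mean P (fun w => expR ((m * U w *+ 2 - m ^+ 2) / (s ^+ 2 *+ 2))) 1.
Proof.
move=> s0 mU lawU.
apply: (normal_law_mean (f := fun x => expR ((m * x *+ 2 - m ^+ 2) / (s ^+ 2 *+ 2))) mU lawU).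
- apply: measurableT_comp => //; apply: measurable_funM => //.
  apply: measurable_funB => //; rewrite (_ : (fun x => _) = (fun x => (m *+ 2) * x)).
    exact: measurable_funM.
  by apply/funext => x; rewrite mulrnAl.
- by move=> x; exact: expR_ge0.
rewrite -(integral_normal_pdf m s); apply: eq_integral => x _; congr EFin.
rewrite !normal_pdfE ?gt_eqF//= -mulrA; congr (_ * _).
rewrite /normal_fun -expRD; congr expR; rewrite -mulrDl; congr (_ / _).
by rewrite subr0; ring.
Qed.

(** Multiplied by the normal density of deviation [s], the integrand becomes [r] times the normal
    density of deviation [s * r]. *)
Lemma normal_law_exp_scale {R : realType} {d : measure_display} {T : measurableType d}
    (P : probability T R) (U : T -> R) (s r : R) :
  0 < s -> 0 < r -> measurable_fun setT U ->
  (forall A, measurable A -> P (U @^-1` A) = normal_prob 0 s A) ->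
  has_mean P (fun w => expR ((1 - r ^- 2) * (U w ^+ 2 / (s ^+ 2 *+ 2)))) r.
Proof.
move=> s0 r0 mU lawU.
apply: (normal_law_mean (f := fun x => expR ((1 - r ^- 2) * (x ^+ 2 / (s ^+ 2 *+ 2)))) mU lawU).
- apply: measurableT_comp => //; apply: measurable_funM => //.
  by apply: measurable_funM => //; exact: measurable_funX.
- by move=> x; exact: expR_ge0.
have sr0 : s * r != 0 by rewrite mulf_neq0// gt_eqF.
have peakE : normal_peak s = r * normal_peak (s * r).
  rewrite /normal_peak (_ : (s * r) ^+ 2 * pi *+ 2 = r ^+ 2 * (s ^+ 2 * pi *+ 2)); last by ring.
  by rewrite sqrtrM ?sqr_ge0// sqrtr_sqr gtr0_norm// invfM mulrA mulfV ?gt_eqF// mul1r.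
transitivity (\int[lebesgue_measure]_x (r%:E * (normal_pdf 0 (s * r) x)%:E))%E.
  apply: eq_integral => x _; rewrite -EFinM; congr EFin.
  rewrite !normal_pdfE ?gt_eqF ?mulr_gt0//= peakE -!mulrA; congr (_ * (_ * _)).
  rewrite /normal_fun -expRD; congr expR; rewrite subr0.
  by field; rewrite !gt_eqF.
rewrite ge0_integralZl_EFin ?ltW//.
- by rewrite integral_normal_pdf mule1.
- by move=> x _; rewrite lee_fin normal_pdf_ge0.
- by apply/measurable_EFinP; exact: measurable_normal_pdf.
Qed.

(** All three moments are read off the exponential identities. The bound [1 + x <= expR x],
    integrated for a whole family of exponents, pins down the first two exactly; a quadratic lower
    bound of the exponential controls the fourth. *)
Lemma normal_law_moments {R : realType} {d : measure_display} {T : measurableType d}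
    (P : probability T R) (U : T -> R) (s : R) :
  0 < s -> measurable_fun setT U ->
  (forall A, measurable A -> P (U @^-1` A) = normal_prob 0 s A) ->
  [/\ has_mean P U 0, has_mean P (fun w => U w ^+ 2) (s ^+ 2) &
      exists2 c, has_mean P (fun w => U w ^+ 4) c & c <= 32 * s ^+ 4].
Proof.
move=> s0 mU lawU.
have s20 : 0 < s ^+ 2 *+ 2 by rewrite pmulrn_lgt0 ?exprn_gt0.
pose Y w := U w ^+ 2 / (s ^+ 2 *+ 2).
have Y0 w : 0 <= Y w by rewrite divr_ge0 ?sqr_ge0// ltW.
have mY : measurable_fun setT Y by apply: measurable_funM => //; exact: measurable_funX.
have expY r : 0 < r -> has_mean P (fun w => expR ((1 - r ^- 2) * Y w)) r.
  by move=> r0; exact: normal_law_exp_scale.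
have UE w : U w ^+ 2 = (s ^+ 2 *+ 2) * Y w by rewrite /Y mulrC divfK// gt_eqF.
(* r = 2 in expY, with exp y >= y ^ 2 / 2 *)
have expY2 w : Y w ^+ 2 <= 32 / 9 * expR ((1 - 2 ^- 2) * Y w).
  have z0 : 0 <= (1 - 2 ^- 2) * Y w.
    rewrite mulr_ge0// (_ : 2 ^- 2 = 1 / 4 :> R); last by field.
    lra.
  have := expR_ge1Dxn 1 z0; rewrite (_ : (2 `!)%:R = 2 :> R)// exprMn.
  rewrite (_ : (1 - 2 ^- 2) ^+ 2 = 9 / 16 :> R); last by field.
  set E := expR _; lra.
have [y2 Y2E] : exists a, has_mean P (fun w => Y w ^+ 2) a.
  apply: has_mean_dominated (has_meanZ (32 / 9) (expY 2 _)) _ => //.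
    exact: measurable_funX.
  by move=> w; rewrite ger0_norm ?sqr_ge0.
have y2_le : y2 <= 32 / 9 * 2.
  exact: has_mean_le Y2E (has_meanZ (32 / 9) (expY 2 _)) expY2.
have [y YE] : exists a, has_mean P Y a.
  apply: has_mean_dominated (has_meanD (has_mean_cst P 1) Y2E) _ => // w.
  rewrite ger0_norm//; have := sqr_ge0 (Y w - 1); have := Y0 w; nra.
have y_le r : 0 < r -> 1 + (1 - r ^- 2) * y <= r.
  move=> r0; apply: has_mean_le (expY r r0) _.
    exact: has_meanD (has_mean_cst P 1) (has_meanZ _ YE).
  by move=> w /=; exact: expR_ge1Dx.
(* After clearing denominators the tangent bound carries a factor [r - 1] on both sides. Dividing by
   it and letting [r] tend to 1 from above gives [y <= 1 / 2], from below the reverse. *)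
have yE : y = 1 / 2.
  have key r : 0 < r -> (r - 1) * (r + 1) * y <= (r - 1) * r ^+ 2.
    move=> r0; have := y_le r r0; rewrite -(ler_pM2l (exprn_gt0 2 r0)).
    rewrite mulrDr mulrA mulrBr mulfV ?expf_neq0 ?gt_eqF//.
    lra.
  apply/eqP; rewrite eq_le; apply/andP; split; apply/ler_addgt0Pr => e e0.
    have e1 : 0 < 1 + e by lra.
    have := key _ e1; rewrite addrAC subrr add0r -!mulrA ler_pM2l// => h.
    have e2 : 0 < 2 + e by lra.
    by rewrite -(ler_pM2l e2); nra.
  have y0 : 0 <= y by exact: has_mean_le (has_mean_cst P 0) YE Y0.
  have [e1|e1] := leP 1 e; first by lra.
  have e2 : 0 < 1 - e by lra.
  have := key _ e2; have -> : 1 - e - 1 = - e by ring.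
  rewrite !mulNr lerN2 -!mulrA ler_pM2l// => h.
  have e3 : 0 < 2 - e by lra.
  by rewrite -(ler_pM2l e3); nra.
have [u UE0] : exists a, has_mean P U a.
  apply: has_mean_dominated (has_meanD (has_mean_cst P 1) (has_meanZ (s ^+ 2 *+ 2) YE)) _ => // w.
  rewrite -UE -[U w ^+ 2]real_normK ?num_real//.
  have := sqr_ge0 (`|U w| - 1); have := normr_ge0 (U w); nra.
(* With the shift equal to the mean [u] itself, the tangent bound integrates to
   [1 + u ^+ 2 / (s ^+ 2 *+ 2) <= 1]. *)
have u0 : u = 0.
  have exp_lin w : 1 + ((u *+ 2 / (s ^+ 2 *+ 2)) * U w + - (u ^+ 2 / (s ^+ 2 *+ 2)))
      <= expR ((u * U w *+ 2 - u ^+ 2) / (s ^+ 2 *+ 2)).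
    apply: le_trans (expR_ge1Dx _); rewrite lerD2l le_eqVlt; apply/orP; left.
    by apply/eqP; field; rewrite gt_eqF.
  have := has_mean_le (has_meanD (has_mean_cst P 1) (has_meanD
    (has_meanZ (u *+ 2 / (s ^+ 2 *+ 2)) UE0) (has_mean_cst P (- (u ^+ 2 / (s ^+ 2 *+ 2))))))
    (normal_law_exp_shift u s0 mU lawU) exp_lin.
  have -> : 1 + (u *+ 2 / (s ^+ 2 *+ 2) * u + - (u ^+ 2 / (s ^+ 2 *+ 2))) =
      1 + u ^+ 2 / (s ^+ 2 *+ 2) by field; rewrite gt_eqF.
  rewrite gerDl pmulr_lle0 ?invr_gt0// => u2.
  by apply/eqP; rewrite -sqrf_eq0 eq_le u2 sqr_ge0.
split; first by rewrite -u0.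
  have := has_meanZ (s ^+ 2 *+ 2) YE.
  rewrite yE (_ : _ * (1 / 2) = s ^+ 2); last by field.
  by congr has_mean; apply/funext => w; rewrite UE.
(* Since [y2 <= 64 / 9], the fourth moment is at most [256 / 9 * s ^+ 4]; the constant 32 rounds
   this up. *)
exists ((s ^+ 2 *+ 2) ^+ 2 * y2).
  have := has_meanZ ((s ^+ 2 *+ 2) ^+ 2) Y2E.
  by congr has_mean; apply/funext => w; rewrite -exprMn -UE -exprM.
have s4 : 0 < s ^+ 4 by rewrite exprn_gt0.
have -> : (s ^+ 2 *+ 2) ^+ 2 * y2 = 4 * s ^+ 4 * y2 by ring.
nra.
Qed.

(** * The drift part of an increment *)

Lemma continuous_measurable_mx {R : realType} {m n : nat} (f : 'M[R]_(m, n) -> R) :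
  continuous f -> measurable_fun setT (f : borelType 'M[R]_(m, n) -> R).
Proof.
move=> cf; apply: (measurability _ (RGenOpens.measurableE R)).
move=> A [B [x [y ->]] <-]; rewrite setTI; apply: sub_sigma_algebra.
by apply: open_comp => [z _|]; [exact: cf|exact: interval_open].
Qed.

Lemma measurable_mx_coord {R : realType} {dO : measure_display}
    {Omega : measurableType dO} {m n : nat} (Y : Omega -> 'M[R]_(m, n)) i j :
  @measurable_fun _ _ Omega (borelType 'M[R]_(m, n)) setT Y ->
  measurable_fun setT (fun w => Y w i j).
Proof.
move=> mY; apply: (measurableT_comp (f := fun v : borelType 'M[R]_(m, n) => v i j)) => //.
by apply: continuous_measurable_mx; exact: coord_continuous.
Qed.

Lemma compact_uniform_continuity {R : realType} (g : R -> R) (K : set R) (e : R) :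
  continuous g -> compact K -> 0 < e ->
  exists2 d : R, 0 < d & forall x, K x -> forall y, `|x - y| < d -> `|g x - g y| < e.
Proof.
move=> cg cK e0.
have : \forall d \near (0 : R)^'+, K `<=`
    (fun x => forall y, `|x - y| < d -> `|g x - g y| < e).
  apply: ((iffLR (compact_near_coveringP K)) cK _ ((0 : R)^'+)
    (fun d x => forall y, `|x - y| < d -> `|g x - g y| < e)) => x Kx.
  have e2 : 0 < e / 2 by rewrite divr_gt0.
  have /cvgrPdist_lt/(_ _ e2)/nbhs_ballP[a /= a0 aP] := cg x.
  have a2 : 0 < a / 2 by rewrite divr_gt0.
  exists (ball x (a / 2), [set d | d < a / 2]); first split => /=.
  - exact: nbhsx_ballx.
  - exact: nbhs_right_lt.
  move=> [x' d] [/= xx' da] y x'y.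
  have gx' : `|g x - g x'| < e / 2.
    by apply: aP; rewrite /ball/= (lt_trans xx')// ltr_pdivrMr// mulr_natr mulr2n ltrDl.
  have gy : `|g x - g y| < e / 2.
    apply: aP; rewrite /ball/= [a]splitr (le_lt_trans (ler_distD x' _ _))//.
    by rewrite ltrD// (lt_trans x'y).
  rewrite [e]splitr (le_lt_trans (ler_distD (g x) _ _))// ltrD// distrC//.
move=> [d /= d0 dP]; exists (d / 2); first by rewrite divr_gt0.
move=> x Kx; apply: (dP (d / 2)) => //=; last by rewrite divr_gt0.
by rewrite /ball/= sub0r normrN gtr0_norm ?divr_gt0// ltr_pdivrMr// mulr_natr mulr2n ltrDl.
Qed.

(** On each cell the mean value theorem writes the increment of a primitive as the step times a
    value of the integrand in that cell, and uniform continuity compares it with the value at the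
    left endpoint. The limit is a difference of integrals from 0 because that is what subtracting
    two instances of the integral equation of a process produces. *)
Lemma riemann_sum_cvg {R : realType} (f : R -> R) (a l : R) :
  0 <= a -> 0 < l -> {within `[0, +oo[, continuous f} ->
  l / n.+1%:R * \sum_(k < n.+1) f (a + k%:R * (l / n.+1%:R)) @[n --> \oo] -->
  \int[@lebesgue_measure R]_(s in `[0, a + l]) f s - \int[@lebesgue_measure R]_(s in `[0, a]) f s.
Proof.
move=> a0 l0 cf.
have [b bE] : exists b, b = a + l by exists (a + l).
have ab : a < b by rewrite bE ltrDl.
rewrite -bE; have -> : l = b - a by rewrite bE; ring.
(* Extending [f] by [f 0] to the negative axis gives a function continuous on the whole line. With
   the primitive started at -1, the point 0 becomes interior and needs no one-sided derivative. *)
pose g (x : R) : R := f (Num.max x 0).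
have gE x : 0 <= x -> g x = f x by move=> x0; rewrite /g max_l.
have cg : continuous g.
  move=> x; have m0 : `[0, +oo[%classic (Num.max x 0) by rewrite /= in_itv/= andbT le_max lexx orbT.
  apply: cvg_comp ((iffLR (subspace_continuousP _ _)) cf _ m0).
  move=> V VP.
  have cm : {for x, continuous (fun y : R => Num.max y 0)}.
    by apply: continuous_max; [exact: cvg_id|exact: cvg_cst].
  have Vx : nbhs x [set y : R | `[0, +oo[%classic (Num.max y 0) -> V (Num.max y 0)].
    exact: cm VP.
  apply: filterS Vx => y /=; apply.
  by rewrite /= in_itv/= andbT le_max lexx orbT.
have gi (u : R) : lebesgue_measure.-integrable `[-1, u] (EFin \o g).
  apply: continuous_compact_integrable; first exact: segment_compact.
  exact: continuous_subspaceT.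
pose F (x : R) : R := \int[@lebesgue_measure R]_(s in `[-1, x]) g s.
have FE (x : R) : 0 <= x -> \int[@lebesgue_measure R]_(s in `[0, x]) f s = F x - F 0.
  move=> x0; rewrite /F (@Rintegral_itvB _ g (BLeft (-1)) (BRight x) 0) //; last first.
    by rewrite bnd_simp; lra.
  rewrite Rintegral_itv_obnd_cbnd.
    by apply: eq_Rintegral => y; rewrite inE/= in_itv/= => /andP[y0 _]; rewrite gE.
  by apply: integrableS (gi x) => //; apply: subset_itvr; rewrite bnd_simp; lra.
have Fder (x : R) : -1 < x -> is_derive x 1 F (g x).
  move=> x1; have [dF <-] := @continuous_FTC1_closed _ g (-1) x (x + 1)
    (ltr_pwDr ltr01 (lexx x)) (gi _) x1 (cg x).
  by rewrite derive1E; exact: DeriveDef.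
have -> : \int[@lebesgue_measure R]_(s in `[0, b]) f s -
    \int[@lebesgue_measure R]_(s in `[0, a]) f s = F b - F a.
  rewrite !FE ?(le_trans a0 (ltW ab))//; ring.
apply/cvgrPdist_le => e e0.
have ba0 : 0 < b - a by rewrite subr_gt0.
have [d d0 dP] := compact_uniform_continuity cg (@segment_compact R a b) (divr_gt0 e0 ba0).
have small : \forall n \near \oo, (b - a) / n.+1%:R < d.
  have := near_infty_natSinv_lt (PosNum (divr_gt0 d0 ba0)); apply: filterS => n /=.
  by rewrite ltr_pdivlMr// mulrC.
apply: filterS small => n nd.
set h := (b - a) / n.+1%:R in nd *.
have h0 : 0 < h by rewrite divr_gt0.
pose t (k : nat) : R := a + k%:R * h.
have tn : t n.+1 = b by rewrite /t /h mulrC divfK// addrC subrK.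
have t0 : t 0%N = a by rewrite /t mul0r addr0.
have tS k : t k.+1 = t k + h by rewrite /t -natr1 mulrDl mul1r addrA.
have ta k : a <= t k by rewrite lerDl mulr_ge0// ltW.
have tb k : (k < n.+1)%N -> t k <= b.
  by move=> kn; rewrite -tn lerD2l ler_pM2r// ler_nat ltnW.
have -> : F b - F a = \sum_(k < n.+1) (F (t k.+1) - F (t k)).
  by rewrite -(big_mkord xpredT (fun k => F (t k.+1) - F (t k))) telescope_sumr// tn t0.
rewrite mulr_sumr -sumrB (le_trans (ler_norm_sum _ _ _))//.
have -> : e = \sum_(k < n.+1) h * (e / (b - a)).
  by rewrite sumr_const card_ord -mulr_natr /h; field; rewrite gt_eqF//= gt_eqF.
apply: ler_sum => k _.
have tlt : t k < t k.+1 by rewrite tS ltrDl.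
have tk := ta k.
have [||c cin ->] := @MVT _ F g (t k) (t k.+1) tlt.
- by move=> x; rewrite in_itv/= => /andP[tx _]; apply: Fder; lra.
- apply: derivable_within_continuous => x; rewrite in_itv/= => /andP[tx _].
  have x1 : -1 < x by lra.
  by have [] := Fder x x1.
rewrite -/(t k) tS addrAC subrr add0r mulrC -gE ?(le_trans a0 (ta _))//.
rewrite -mulrBr normrM gtr0_norm// ler_pM2l// distrC ltW//.
apply: dP; first by rewrite /= in_itv/= ta tb.
move: cin; rewrite in_itv/= tS => /andP[tc ct].
by rewrite distrC gtr0_norm ?subr_gt0// (lt_trans _ nd)// ltrBlDl.
Qed.

Lemma sqr_sum_le {R : realType} (n : nat) (a : 'I_n -> R) :
  (\sum_i a i) ^+ 2 <= n%:R * \sum_i a i ^+ 2.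
Proof.
have -> : n%:R * \sum_i a i ^+ 2 = \sum_i \sum_j (a i ^+ 2 + a j ^+ 2) / 2.
  transitivity (\sum_(i < n) (n%:R * a i ^+ 2 + \sum_j a j ^+ 2) / 2).
    rewrite -mulr_suml big_split/= -mulr_sumr sumr_const card_ord.
    by rewrite -[X in _ + X]mulr_natl; field.
  apply: eq_bigr => i _; rewrite -mulr_suml big_split/= sumr_const card_ord.
  by rewrite mulr_natl.
rewrite expr2 mulr_suml; apply: ler_sum => i _; rewrite mulr_sumr.
apply: ler_sum => j _; rewrite ler_pdivlMr//; have := sqr_ge0 (a i - a j); nra.
Qed.

Lemma enorm_ge0 {R : realType} {d : nat} (v : 'cV[R]_d) : 0 <= enorm v.
Proof. exact: sqrtr_ge0. Qed.

Lemma enorm_exp2 {R : realType} {d : nat} (v : 'cV[R]_d) (m : nat) :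
  enorm v ^+ (2 * m) = (\sum_(i < d) v i 0 ^+ 2) ^+ m.
Proof. by rewrite exprM sqr_sqrtr// sumr_ge0// => i _; exact: sqr_ge0. Qed.

Lemma expr1D_le {R : realType} (x : R) (k : nat) :
  0 <= x -> (1 + x) ^+ k <= 2 ^+ k * (1 + x ^+ k).
Proof.
move=> x0; have [x1|x1] := leP x 1.
  apply: (@le_trans _ _ (2 ^+ k)); last by rewrite ler_peMr ?exprn_ge0// lerDl exprn_ge0.
  by rewrite lerXn2r// ?nnegrE; lra.
apply: (@le_trans _ _ (2 ^+ k * x ^+ k)).
  by rewrite -exprMn lerXn2r// ?nnegrE; lra.
by rewrite ler_pM2l ?exprn_gt0// lerDr.
Qed.

(** Squaring the growth bound leads to the moment of even order [2 * m], where the power of the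
    Euclidean norm is a polynomial in the coordinates. *)
Lemma poly_growth_second_moment {R : realType} {dO : measure_display}
    {Omega : measurableType dO} (P : probability Omega R) {d : nat}
    (Y : R -> Omega -> 'cV[R]_d) (f : 'cV[R]_d -> R) :
  measurable_process Y -> bounded_moments P Y -> continuous f -> poly_growth f ->
  exists2 C : R, 0 <= C &
    forall t, 0 <= t -> (\int[P]_w (f (Y t w) ^+ 2)%:E <= C%:E)%E.
Proof.
move=> mY momY cf [c [m fb]].
pose S := ereal_sup
  [set 'E_P[fun w => (enorm (Y t w) `^ (2 * m)%:R)%R] | t in [set t : R | (0 <= t)%R]]%E.
have Sfin : (S < +oo)%E by exact: momY.
have S0 : (0 <= S)%E.
  apply: (@le_trans _ _ 'E_P[fun w => (enorm (Y 0%R w) `^ (2 * m)%:R)%R]%E).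
    by apply: expectation_ge0 => w; exact: powR_ge0.
  by apply: ereal_sup_ubound; exists 0 => //=.
have SE : S = (fine S)%:E by rewrite fineK// ge0_fin_numE.
have fS0 : 0 <= fine S by exact: fine_ge0.
pose K := c ^+ 2 * 2 ^+ (2 * m).
have K0 : 0 <= K by rewrite mulr_ge0 ?sqr_ge0// exprn_ge0.
have fsq y : f y ^+ 2 <= K * (1 + (\sum_(i < d) y i 0 ^+ 2) ^+ m).
  rewrite -enorm_exp2 -mulrA -real_normK ?num_real//.
  apply: (@le_trans _ _ (c ^+ 2 * (1 + enorm y) ^+ (2 * m))).
    rewrite mulnC exprM -exprMn lerXn2r// ?nnegrE//; first exact: le_trans (fb y).
  by apply: ler_wpM2l; [exact: sqr_ge0|exact: expr1D_le (enorm_ge0 _)].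
exists (K * (1 + fine S)); first by rewrite mulr_ge0// addr_ge0.
move=> t t0.
have mcoord i : measurable_fun setT (fun w => Y t w i 0).
  exact: measurable_mx_coord (mY t t0).
have mpow : measurable_fun setT (fun w => (\sum_(i < d) Y t w i 0 ^+ 2) ^+ m).
  by apply: measurable_funX; apply: measurable_sum => i; exact: measurable_funX.
have mf : measurable_fun setT (fun w => f (Y t w)).
  exact: measurableT_comp (continuous_measurable_mx cf) (mY t t0).
apply: (@le_trans _ _ (\int[P]_w (K%:E * (1 + ((\sum_(i < d) Y t w i 0 ^+ 2) ^+ m)%:E)))%E).
  apply: ge0_le_integral => //.
  - by move=> w _; rewrite lee_fin sqr_ge0.
  - by apply/measurable_EFinP; exact: measurable_funX.
  - apply: measurable_funeM; apply: emeasurable_funD => //; exact/measurable_EFinP.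
  - by move=> w _; rewrite -EFinD -EFinM lee_fin.
have sum0 w : 0 <= (\sum_(i < d) Y t w i 0 ^+ 2) ^+ m.
  by rewrite exprn_ge0// sumr_ge0// => i _; exact: sqr_ge0.
rewrite ge0_integralZl//; last 2 first.
- by apply: emeasurable_funD => //; exact/measurable_EFinP.
- by move=> w _; rewrite adde_ge0// lee_fin.
rewrite [X in (_ <= X)%E]EFinM; apply: lee_wpmul2l; first by rewrite lee_fin.
rewrite ge0_integralD//; last 2 first.
- by move=> w _; rewrite lee_fin.
- exact/measurable_EFinP.
rewrite integral_cst//= probability_setT mul1e EFinD leeD2l// -SE.
apply: ereal_sup_ubound; exists t => //=; rewrite unlock.
by apply: eq_integral => w _; rewrite powR_mulrn ?enorm_ge0// enorm_exp2.
Qed.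

(* The drift part of an increment is the almost sure limit of Riemann sums of
   B (Y t), each of second moment O(l ^ 2); Fatou's lemma then dispenses with
   joint measurability of (t, w) |-> Y t w. *)
Lemma drift_second_moment {R : realType} {dO : measure_display}
    {Omega : measurableType dO} (P : probability Omega R) {d r : nat}
    (B : 'cV[R]_d -> 'cV[R]_d) (S : 'M[R]_(d, r)) (W : R -> Omega -> 'cV[R]_r)
    (c : 'cV[R]_d) (Y : R -> Omega -> 'cV[R]_d) :
  measurable_process W -> sde_solution P B S W c Y -> regular_drift B ->
  bounded_moments P Y ->
  exists2 C : R, 0 <= C & forall (s l : R) (i : 'I_d), 0 <= s -> 0 < l ->
    let D w := (Y (s + l) w - Y s w - S *m (W (s + l) w - W s w)) i 0 in
    measurable_fun setT D /\ (\int[P]_w (D w ^+ 2)%:E <= (C * l ^+ 2)%:E)%E.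
Proof.
move=> mW [mY pathsY eqY] [_ regB] momY.
have cB i : continuous (fun x => B x i 0) by have [/(_ [::] isT)[]] := regB i.
have /choice[C CP] : forall i, exists C, 0 <= C /\
    forall t, 0 <= t -> (\int[P]_w (B (Y t w) i 0 ^+ 2)%:E <= C%:E)%E.
  move=> i; have [_ /(_ [::] isT) growB] := regB i.
  by have [C C0 CP] := poly_growth_second_moment mY momY (cB i) growB; exists C.
exists (\sum_i C i); first by apply: sumr_ge0 => i _; exact: (CP i).1.
move=> s l i s0 l0 D.
have sl0 : 0 <= s + l by rewrite addr_ge0// ltW.
have mD : measurable_fun setT D.
  have -> : D = (fun w => Y (s + l) w i 0 - Y s w i 0
      - \sum_j S i j * (W (s + l) w j 0 - W s w j 0)).
    apply/funext => w; rewrite /D !mxE; congr (_ - _).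
    by apply: eq_bigr => j _; rewrite !mxE.
  have mWj t j : 0 <= t -> measurable_fun setT (fun w => W t w j 0).
    by move=> t0; exact: measurable_mx_coord (mW t t0).
  apply: measurable_funB.
    by apply: measurable_funB; apply: measurable_mx_coord; exact: mY.
  by apply: measurable_sum => j; apply: measurable_funM => //; apply: measurable_funB; exact: mWj.
split=> //.
pose b t w := B (Y t w) i 0.
have mb t : 0 <= t -> measurable_fun setT (b t).
  by move=> t0; exact: measurableT_comp (continuous_measurable_mx (cB i)) (mY t t0).
pose t n (k : nat) := s + k%:R * (l / n.+1%:R).
have t0 n k : 0 <= t n k by rewrite addr_ge0// mulr_ge0// divr_ge0// ltW.
pose Rn n w := l / n.+1%:R * \sum_(k < n.+1) b (t n k) w.
have mRn n : measurable_fun setT (fun w => (Rn n w ^+ 2)%:E).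
  apply/measurable_EFinP; apply: measurable_funX; apply: measurable_funM => //.
  by apply: measurable_sum => k; exact: mb.
have Rn0 n w : (0 <= (Rn n w ^+ 2)%:E)%E by rewrite lee_fin sqr_ge0.
(* Cauchy-Schwarz over the [n.+1] nodes makes the bound independent of [n]: the factors in
   [(l / n.+1) ^ 2 * n.+1 * (n.+1 * C i)] cancel to [C i * l ^ 2]. *)
have momRn n : (\int[P]_w (Rn n w ^+ 2)%:E <= (C i * l ^+ 2)%:E)%E.
  pose K := (l / n.+1%:R) ^+ 2 * n.+1%:R.
  have K0 : 0 <= K by rewrite mulr_ge0 ?sqr_ge0.
  have mb2 k : measurable_fun setT (fun w => (b (t n k) w ^+ 2)%:E).
    by apply/measurable_EFinP/measurable_funX/mb.
  apply: (@le_trans _ _ (\int[P]_w (K%:E * \sum_(k < n.+1) (b (t n k) w ^+ 2)%:E))%E).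
    apply: ge0_le_integral => //.
    - by apply: measurable_funeM; apply: emeasurable_sum => k.
    - move=> w _; rewrite sumEFin -EFinM lee_fin exprMn /K -[X in _ <= X]mulrA.
      by rewrite ler_wpM2l ?sqr_ge0// sqr_sum_le.
  rewrite ge0_integralZl//; last 2 first.
  - by apply: emeasurable_sum => k.
  - by move=> w _; rewrite sumEFin lee_fin sumr_ge0// => k _; rewrite sqr_ge0.
  rewrite ge0_integral_sum//; last by move=> k w _; rewrite lee_fin sqr_ge0.
  have -> : (C i * l ^+ 2)%:E = (K%:E * (\sum_(k < n.+1) C i)%:E)%E.
    rewrite -EFinM sumr_const card_ord -[_ *+ _]mulr_natl /K; congr EFin.
    by field.
  apply: lee_wpmul2l; first by rewrite lee_fin.
  by rewrite -sumEFin; apply: lee_sum => k _; exact: (CP i).2.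
(* Subtracting the integral equations at [s + l] and [s] removes the initial value and the noise,
   leaving the integral of a path that is continuous for almost every [w]. *)
have limRn : {ae P, forall w, (Rn n w ^+ 2)%:E @[n --> \oo] --> (D w ^+ 2)%:E}.
  apply: filterS2 pathsY eqY => w cYw Yw.
  have cb : {within `[0, +oo[, continuous (fun u => b u w)}.
    move=> u; apply: (@continuous_comp _ _ _
      ((fun v => Y v w) : subspace `[0, +oo[ -> 'cV[R]_d) (fun x => B x i 0)).
      exact: cYw.
    exact: cB.
  have DE : D w = \int[@lebesgue_measure R]_(u in `[0, s + l]) b u w
                - \int[@lebesgue_measure R]_(u in `[0, s]) b u w.
    have Yw1 := congr1 (fun v : 'cV[R]_d => v i 0) (Yw _ sl0).
    have Yw2 := congr1 (fun v : 'cV[R]_d => v i 0) (Yw _ s0).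
    rewrite /D mulmxBr; rewrite !mxE in Yw1 Yw2 *; rewrite Yw1 Yw2 /b.
    ring.
  have /= limR := riemann_sum_cvg s0 l0 cb.
  apply: cvg_EFin; first exact: nearW.
  by rewrite DE; exact: (cvgM limR limR).
apply: (@le_trans _ _ (C i * l ^+ 2)%:E); last first.
  rewrite lee_fin ler_wpM2r ?sqr_ge0// (bigD1 i)//= lerDl sumr_ge0// => j _.
  exact: (CP j).1.
(* The limit holds only almost surely, so the comparison goes through the lower limit, which is
   defined and measurable everywhere. *)
apply: (@le_trans _ _ (\int[P]_w limn_einf (fun n => (Rn n w ^+ 2)%:E))%E).
  apply: ae_ge0_le_integral => //.
  - by move=> w _; rewrite lee_fin sqr_ge0.
  - by apply/measurable_EFinP; exact: measurable_funX.
  - move=> w _; rewrite limn_einf_lim; apply: lime_ge; first exact: is_cvg_einfs.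
    by apply: nearW => n; apply: le_ereal_inf_tmp => _ [k _ <-].
  - rewrite (_ : (fun w => _) =
        (fun w => - limn_esup (fun n => - (Rn n w ^+ 2)%:E))%E); last first.
      apply/funext => w; rewrite -limn_einfN; congr limn_einf.
      by apply/funext => n; exact/esym/oppeK.
    apply: measurableT_comp => //.
    by apply: measurable_fun_limn_esup => n; exact: measurableT_comp.
  - apply: filterS limRn => w Dw _.
    by rewrite is_cvg_limn_einfE; [rewrite (cvg_lim _ Dw)|apply/cvg_ex; eexists; exact: Dw].
apply: (le_trans (fatou P measurableT mRn (fun n w _ => Rn0 n w))).
rewrite limn_einf_lim; apply: lime_le; first exact: is_cvg_einfs.
apply: nearW => n; apply: le_trans (momRn n).
by apply: ereal_inf_lbound; exists n => /=.
Qed.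

(** * Quadratic variation *)

(** Indices outside [s] receive the constant factor 1, so means are required along [s] only; this
    serves products of two or four increments. *)
Lemma independent_mean_prod_seq {R : realType} {d : measure_display}
    {T : measurableType d} (P : probability T R) {I : finType}
    (X : I -> T -> R) (s : seq I) (g : I -> R -> R) (c : I -> R) :
  (forall i, measurable_fun setT (X i)) ->
  independent P (fun i => preimage_set_system setT (X i) measurable) -> uniq s ->
  (forall i, measurable_fun setT (g i)) ->
  (forall i, i \in s -> has_mean P (g i \o X i) (c i)) ->
  has_mean P (fun w => \prod_(i <- s) g i (X i w)) (\prod_(i <- s) c i).
Proof.
move=> mX indepX us mg gc.
pose g' i := if i \in s then g i else fun=> 1.
pose c' i := if i \in s then c i else 1.
have := independent_mean_prod (g := g') (c := c') mX indepX.
have -> : \prod_i c' i = \prod_(i <- s) c i.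
  by rewrite [RHS]big_uniq// [RHS]big_mkcond.
have -> : (fun w => \prod_i g' i (X i w)) = (fun w => \prod_(i <- s) g i (X i w)).
  apply/funext => w; rewrite [RHS]big_uniq// [RHS]big_mkcond.
  by apply: eq_bigr => i _; rewrite /g'; case: ifP.
apply; first by move=> i; rewrite /g'; case: ifP => // _; exact: measurable_cst.
by move=> i; rewrite /g' /c'; case: ifP => [/gc//|_]; exact: has_mean_cst.
Qed.

(** The summands are centred and uncorrelated for distinct [i], so only the [n] diagonal terms of
    the squared sum survive, each at most [32 * s ^+ 4]. *)
Lemma noise_cov_second_moment {R : realType} {d : measure_display}
    {T : measurableType d} (P : probability T R) {n r : nat}
    (U : 'I_n -> 'I_r -> T -> R) (s : R) (a b : 'I_r) :
  0 < s -> (forall i j, measurable_fun setT (U i j)) ->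
  (forall i j A, measurable A -> P (U i j @^-1` A) = normal_prob 0 s A) ->
  independent P (fun u : 'I_n * 'I_r =>
    preimage_set_system setT (U u.1 u.2) measurable) ->
  exists2 c, has_mean P
      (fun w => (\sum_i (U i a w * U i b w - (a == b)%:R * s ^+ 2)) ^+ 2) c &
    c <= n%:R * (32 * s ^+ 4).
Proof.
move=> s0 mU lawU indepU.
pose X (u : 'I_n * 'I_r) := U u.1 u.2.
have mX u : measurable_fun setT (X u) by exact: mU.
have mom i j := normal_law_moments s0 (mU i j) (lawU i j).
have mean1 i j : has_mean P (U i j) 0 by have [] := mom i j.
have mean2 i j : has_mean P (fun w => U i j w ^+ 2) (s ^+ 2) by have [] := mom i j.
pose Z i w := U i a w * U i b w - (a == b)%:R * s ^+ 2.
(* For [a = b] this is a product of two independent centred factors [U ^+ 2 - s ^+ 2]; for distinct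
   [a] and [b] it is a product of four distinct independent centred increments. *)
have cross i j : i != j -> has_mean P (fun w => Z i w * Z j w) 0.
  move=> ij; have [ab|ab] := eqVneq a b.
    have := independent_mean_prod_seq (X := X) (s := [:: (i, a); (j, a)])
      (g := fun=> fun x => x ^+ 2 - s ^+ 2) (c := fun=> 0) mX indepU.
    rewrite !big_cons big_nil !mul0r.
    have -> : (fun w => \prod_(u <- [:: (i, a); (j, a)]) (X u w ^+ 2 - s ^+ 2)) =
        (fun w => Z i w * Z j w).
      by apply/funext => w; rewrite !big_cons big_nil /Z /X -ab eqxx/=; ring.
    apply; first by rewrite /= inE xpair_eqE (negbTE ij).
      by move=> _; apply: measurable_funB => //; exact: measurable_funX.
    move=> [k l] _.
    have := has_meanD (mean2 k l) (has_mean_cst P (- s ^+ 2)).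
    by rewrite subrr.
  have := independent_mean_prod_seq (X := X)
    (s := [:: (i, a); (i, b); (j, a); (j, b)]) (g := fun=> id) (c := fun=> 0) mX indepU.
  rewrite !big_cons big_nil !mul0r.
  have -> : (fun w => \prod_(u <- [:: (i, a); (i, b); (j, a); (j, b)]) id (X u w)) =
      (fun w => Z i w * Z j w).
    by apply/funext => w; rewrite !big_cons big_nil /Z /X (negbTE ab)/=; ring.
  apply => //; last by move=> [k l] _; exact: mean1.
  by rewrite /= !inE !xpair_eqE !(negbTE ij) !(negbTE ab) ?andbF.
have diag i : exists2 c, has_mean P (fun w => Z i w * Z i w) c & c <= 32 * s ^+ 4.
  have s4 : 0 < s ^+ 4 by rewrite exprn_gt0.
  have [ab|ab] := eqVneq a b.
    have [_ _ [c m4 c4]] := mom i a.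
    exists (c + (- (s ^+ 2 *+ 2) * s ^+ 2 + s ^+ 4)); last by nra.
    have := has_meanD m4 (has_meanD (has_meanZ (- (s ^+ 2 *+ 2)) (mean2 i a))
      (has_mean_cst P (s ^+ 4))).
    by congr has_mean; apply/funext => w; rewrite /Z -ab eqxx/=; ring.
  exists (s ^+ 4); last by nra.
  have := independent_mean_prod_seq (X := X) (s := [:: (i, a); (i, b)])
    (g := fun=> fun x => x ^+ 2) (c := fun=> s ^+ 2) mX indepU.
  rewrite !big_cons big_nil mulr1 -exprD.
  have -> : (fun w => \prod_(u <- [:: (i, a); (i, b)]) (X u w ^+ 2)) =
      (fun w => Z i w * Z i w).
    by apply/funext => w; rewrite !big_cons big_nil /Z /X (negbTE ab)/=; ring.
  apply; last by move=> [k l] _; exact: mean2.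
    by rewrite /= inE xpair_eqE eqxx (negbTE ab).
  by move=> _; exact: measurable_funX.
have /choice[e eP] : forall ij : 'I_n * 'I_n, exists c,
    has_mean P (fun w => Z ij.1 w * Z ij.2 w) c /\
    c <= if ij.1 == ij.2 then 32 * s ^+ 4 else 0.
  move=> [i j] /=; case: eqVneq => [<-|ij].
    by have [c m c32] := diag i; exists c.
  by exists 0; split=> //; exact: cross.
exists (\sum_i \sum_j e (i, j)).
  have -> : (fun w => (\sum_i Z i w) ^+ 2) = (fun w => \sum_i \sum_j Z i w * Z j w).
    by apply/funext => w; rewrite expr2 mulr_suml; apply: eq_bigr => i _; rewrite mulr_sumr.
  by apply: has_mean_sum => i; apply: has_mean_sum => j; exact: (eP (i, j)).1.
rewrite -[n in n%:R]card_ord mulr_natl -sumr_const; apply: ler_sum => i _.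
rewrite (bigD1 i)//= -[leRHS]addr0 lerD//.
  by have := (eP (i, i)).2; rewrite eqxx.
apply: sumr_le0 => j ji; have := (eP (i, j)).2; by rewrite /= eq_sym (negbTE ji).
Qed.

(** The bound is asked for [n > 0] only, because the normalization by [n%:R * h n] degenerates at 0.
    An explicit real majorant [u] keeps the limits in [R]. *)
Definition L1_null {R : realType} {d : measure_display} {T : measurableType d}
    (P : {measure set T -> \bar R}) (Z : nat -> T -> R) : Prop :=
  (forall n, measurable_fun setT (Z n)) /\
  exists2 u : nat -> R, u n @[n --> \oo] --> 0 &
    forall n, (0 < n)%N -> (\int[P]_w `|Z n w|%:E <= (u n)%:E)%E.

Lemma L1_null_dominated {R : realType} {d : measure_display} {T : measurableType d}
    (P : {measure set T -> \bar R}) (Z Z' : nat -> T -> R) :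
  (forall n, measurable_fun setT (Z n)) -> L1_null P Z' ->
  (forall n w, (0 < n)%N -> `|Z n w| <= `|Z' n w|) -> L1_null P Z.
Proof.
move=> mZ [mZ' [u u0 uP]] ZZ'; split=> //; exists u => // n n0.
apply: le_trans (uP n n0); apply: ge0_le_integral => //.
- by apply/measurable_EFinP; exact: measurableT_comp.
- by apply/measurable_EFinP; exact: measurableT_comp.
- by move=> w _; rewrite lee_fin; exact: ZZ'.
Qed.

Lemma L1_nullD {R : realType} {d : measure_display} {T : measurableType d}
    (P : {measure set T -> \bar R}) (Z Z' : nat -> T -> R) :
  L1_null P Z -> L1_null P Z' -> L1_null P (fun n w => Z n w + Z' n w).
Proof.
move=> [mZ [u u0 uP]] [mZ' [v v0 vP]]; split.
  by move=> n; exact: measurable_funD.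
exists (fun n => u n + v n); first by rewrite -[X in _ --> X]addr0; exact: cvgD.
move=> n n0; rewrite EFinD; apply: le_trans (leeD (uP n n0) (vP n n0)).
rewrite -ge0_integralD//; last 2 first.
- by apply/measurable_EFinP; exact: measurableT_comp.
- by apply/measurable_EFinP; exact: measurableT_comp.
apply: ge0_le_integral => //.
- by apply/measurable_EFinP; apply: measurableT_comp => //; exact: measurable_funD.
- by apply/measurable_EFinP; apply: measurable_funD; exact: measurableT_comp.
- by move=> w _; rewrite lee_fin ler_normD.
Qed.

Lemma L1_nullZ {R : realType} {d : measure_display} {T : measurableType d}
    (P : {measure set T -> \bar R}) (Z : nat -> T -> R) (c : R) :
  L1_null P Z -> L1_null P (fun n w => c * Z n w).
Proof.
move=> [mZ [u u0 uP]]; split; first by move=> n; exact: measurable_funM.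
exists (fun n => `|c| * u n).
  by rewrite -[X in _ --> X](mulr0 `|c|); apply: cvgM => //; exact: cvg_cst.
move=> n n0; under eq_integral do rewrite normrM EFinM.
rewrite ge0_integralZl//; last first.
  by apply/measurable_EFinP; exact: measurableT_comp.
by rewrite EFinM; apply: lee_wpmul2l => //; exact: uP.
Qed.

Lemma L1_null0 {R : realType} {d : measure_display} {T : measurableType d}
    (P : {measure set T -> \bar R}) : L1_null P (fun _ _ => 0 : R).
Proof.
split; first by move=> n; exact: measurable_cst.
exists (fun=> 0); first exact: cvg_cst.
by move=> n _; under eq_integral do rewrite normr0; rewrite integral0.
Qed.

Lemma L1_null_sum {R : realType} {d : measure_display} {T : measurableType d}
    (P : {measure set T -> \bar R}) (I : Type) (s : seq I) (Z : I -> nat -> T -> R) :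
  (forall i, L1_null P (Z i)) -> L1_null P (fun n w => \sum_(i <- s) Z i n w).
Proof.
move=> Z0; elim: s => [|i s IH].
  by have := L1_null0 P; congr L1_null; apply/funext => n; apply/funext => w; rewrite big_nil.
have := L1_nullD (Z0 i) IH; congr L1_null.
by apply/funext => n; apply/funext => w; rewrite big_cons.
Qed.

Lemma cvg_invn {R : realType} : (n%:R^-1 : R) @[n --> \oo] --> 0.
Proof. by rewrite -cvg_shiftS; exact: cvg_harmonic. Qed.

Lemma cvg_sqrt0 {R : realType} (u : nat -> R) :
  u n @[n --> \oo] --> 0 -> Num.sqrt (u n) @[n --> \oo] --> 0.
Proof.
move=> u0; rewrite -[X in _ --> X]sqrtr0.
by apply: continuous_cvg => //; exact: sqrt_continuous.
 Qed.

(** The pointwise bound [|z| <= z ^+ 2 / (2 * x) + x / 2] replaces Cauchy-Schwarz;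
    [x = Num.sqrt n%:R^-1] balances the two terms. *)
Lemma L1_null_of_second_moment {R : realType} {d : measure_display}
    {T : measurableType d} (P : probability T R) (Z : nat -> T -> R) (K : R) :
  (forall n, measurable_fun setT (Z n)) ->
  (forall n, (0 < n)%N -> exists2 c, has_mean P (fun w => Z n w ^+ 2) c & c <= K / n%:R) ->
  L1_null P Z.
Proof.
move=> mZ Z2; split=> //.
exists (fun n => (K + 1) / 2 * Num.sqrt n%:R^-1).
  rewrite -[X in _ --> X](mulr0 ((K + 1) / 2)); apply: cvgM; first exact: cvg_cst.
  exact: cvg_sqrt0 cvg_invn.
move=> n n0; have [c mc cK] := Z2 n n0.
set x := Num.sqrt n%:R^-1.
have x0 : 0 < x by rewrite sqrtr_gt0 invr_gt0 ltr0n.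
have xx : x ^+ 2 = n%:R^-1 by rewrite sqr_sqrtr// invr_ge0.
have bound w : `|Z n w| <= (2 * x)^-1 * Z n w ^+ 2 + x / 2.
  have -> : (2 * x)^-1 * Z n w ^+ 2 + x / 2 = (`|Z n w| ^+ 2 + x ^+ 2) / (2 * x).
    by rewrite real_normK ?num_real//; field; rewrite gt_eqF.
  rewrite ler_pdivlMr ?mulr_gt0//; have := sqr_ge0 (`|Z n w| - x); nra.
have [_ meanB] := has_meanD (has_meanZ (2 * x)^-1 mc) (has_mean_cst P (x / 2)).
apply: (@le_trans _ _ (\int[P]_w ((2 * x)^-1 * Z n w ^+ 2 + x / 2)%:E)%E).
  apply: ge0_le_integral => //.
  - by apply/measurable_EFinP; exact: measurableT_comp.
  - apply/measurable_EFinP; apply: measurable_funD => //.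
    by apply: measurable_funM => //; exact: measurable_funX.
  - by move=> w _; rewrite lee_fin.
rewrite meanB lee_fin.
have -> : (K + 1) / 2 * x = (2 * x)^-1 * (K * x ^+ 2) + x / 2.
  by field; rewrite gt_eqF.
by rewrite lerD2r ler_wpM2l ?invr_ge0 ?mulr_ge0 ?(ltW x0)// xx.
Qed.

Lemma integral_avg_le {R : realType} {d : measure_display} {T : measurableType d}
    (P : {measure set T -> \bar R}) (n : nat) (f : 'I_n -> T -> R) (a c : R) :
  (forall i, measurable_fun setT (f i)) -> (forall i w, 0 <= f i w) -> 0 <= a ->
  (forall i, (\int[P]_w (f i w)%:E <= c%:E)%E) ->
  (\int[P]_w (a * \sum_i f i w)%:E <= (a * (n%:R * c))%:E)%E.
Proof.
move=> mf f0 a0 fc.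
under eq_integral do rewrite EFinM -sumEFin.
rewrite ge0_integralZl//; last 2 first.
- by apply: emeasurable_sum => i; exact/measurable_EFinP.
- by move=> w _; rewrite sumEFin lee_fin sumr_ge0.
rewrite ge0_integral_sum//; last 2 first.
- by move=> i; exact/measurable_EFinP.
- by move=> i w _; rewrite lee_fin.
rewrite [X in (_ <= X)%E]EFinM; apply: lee_wpmul2l; first by rewrite lee_fin.
rewrite -[n in n%:R]card_ord mulr_natl -sumr_const -sumEFin.
by apply: lee_sum => i _; exact: fc.
Qed.

(** The product of two increments expands into drift-drift terms, of order [h n] after
    normalization, drift-noise terms, of order [Num.sqrt (h n)], and noise-noise terms, which
    concentrate around [S *m S^T] at rate [Num.sqrt n%:R^-1]. *)
Lemma quadratic_variation_L1 {R : realType} {d : measure_display}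
    {T : measurableType d} (P : probability T R) {p r : nat} (h : nat -> R)
    (D : forall n, 'I_n -> 'I_p -> T -> R) (U : forall n, 'I_n -> 'I_r -> T -> R)
    (S : 'M[R]_(p, r)) (C : R) :
  (forall n, 0 < h n) -> h n @[n --> \oo] --> 0 -> 0 <= C ->
  (forall n i k, measurable_fun setT (D n i k)) ->
  (forall n i k, (\int[P]_w (D n i k w ^+ 2)%:E <= (C * h n ^+ 2)%:E)%E) ->
  (forall n i a, measurable_fun setT (U n i a)) ->
  (forall n i a A, measurable A ->
    P (U n i a @^-1` A) = normal_prob 0 (Num.sqrt (h n)) A) ->
  (forall n, independent P (fun u : 'I_n * 'I_r =>
    preimage_set_system setT (U n u.1 u.2) measurable)) ->
  forall k l, L1_null P (fun n w => (n%:R * h n)^-1 *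
      (\sum_i (D n i k w + \sum_a S k a * U n i a w) *
              (D n i l w + \sum_a S l a * U n i a w)) - (S *m S^T) k l).
Proof.
move=> h0 hcvg C0 mD momD mU lawU indepU k l.
pose T' n := (n%:R * h n)^-1.
have T0 n : 0 <= T' n by rewrite invr_ge0 mulr_ge0// ltW.
have sh0 n : 0 < Num.sqrt (h n) by rewrite sqrtr_gt0.
have shh n : Num.sqrt (h n) ^+ 2 = h n by rewrite sqr_sqrtr// ltW.
have Tn n x : (0 < n)%N -> T' n * (n%:R * (h n * x)) = x.
  by move=> n0; rewrite /T'; field; rewrite !gt_eqF// ltr0n.
have momU n i a : (\int[P]_w (U n i a w ^+ 2)%:E = (h n)%:E)%E.
  by have [_ [_ ->] _] := normal_law_moments (sh0 n) (mU n i a) (lawU n i a); rewrite shh.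
have mavg n (f : 'I_n -> T -> R) : (forall i, measurable_fun setT (f i)) ->
    measurable_fun setT (fun w => T' n * \sum_i f i w).
  by move=> mf; apply: measurable_funM => //; exact: measurable_sum.
have avg_ge0 n (f : 'I_n -> T -> R) w : (forall i, 0 <= f i w) -> 0 <= T' n * \sum_i f i w.
  by move=> f0; rewrite mulr_ge0// sumr_ge0.
have DU j a : L1_null P (fun n w => T' n * \sum_i D n i j w * U n i a w).
  pose s n := Num.sqrt (h n).
  have s0 n : 0 <= s n by exact: ltW (sh0 n).
  pose f n (i : 'I_n) w := (s n)^-1 * D n i j w ^+ 2 + s n * U n i a w ^+ 2.
  have mf n i : measurable_fun setT (f n i).
    by apply: measurable_funD; apply: measurable_funM => //; exact: measurable_funX.
  have f0 n i w : 0 <= f n i w.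
    by rewrite /f addr_ge0// mulr_ge0 ?sqr_ge0// invr_ge0.
  apply: (@L1_null_dominated _ _ _ _ _ (fun n w => T' n * \sum_i f n i w)).
  - by move=> n; apply: mavg => i; exact: measurable_funM.
  - split; first by move=> n; exact: mavg.
    exists (fun n => (C + 1) * s n).
      rewrite -[X in _ --> X](mulr0 (C + 1)); apply: cvgM; first exact: cvg_cst.
      exact: cvg_sqrt0.
    move=> n n0; under eq_integral do rewrite ger0_norm ?avg_ge0//.
    rewrite -(Tn n ((C + 1) * s n) n0); apply: integral_avg_le => // i.
    under eq_integral do rewrite EFinD (EFinM (s n)^-1) (EFinM (s n)).
    have mD2 : measurable_fun setT (fun w => (D n i j w ^+ 2)%:E).
      by apply/measurable_EFinP; exact: measurable_funX.
    have mU2 : measurable_fun setT (fun w => (U n i a w ^+ 2)%:E).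
      by apply/measurable_EFinP; exact: measurable_funX.
    have si0 : 0 <= (s n)^-1 by rewrite invr_ge0.
    rewrite ge0_integralD//; last 4 first.
    - by move=> w _; rewrite -EFinM lee_fin mulr_ge0// sqr_ge0.
    - exact: measurable_funeM.
    - by move=> w _; rewrite -EFinM lee_fin mulr_ge0 ?sqr_ge0.
    - exact: measurable_funeM.
    rewrite !ge0_integralZl//; last 3 first.
    - by move=> w _; rewrite lee_fin sqr_ge0.
    - by rewrite lee_fin.
    - by move=> w _; rewrite lee_fin sqr_ge0.
    have -> : h n * ((C + 1) * s n) = (s n)^-1 * (C * h n ^+ 2) + s n * h n.
      have hs : h n = s n ^+ 2 by rewrite /s shh.
      have : (s n == 0) = false by rewrite gt_eqF//; exact: sh0.
      by move: (s n) hs => x -> x0; field; rewrite x0.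
    rewrite momU EFinD EFinM; apply: leeD; last by rewrite EFinM.
    by apply: lee_wpmul2l; [rewrite lee_fin|exact: momD].
  - move=> n w n0; rewrite [leRHS]ger0_norm ?avg_ge0//.
    rewrite normrM ger0_norm// ler_wpM2l// (le_trans (ler_norm_sum _ _ _))//.
    apply: ler_sum => i _; rewrite /f normrM.
    have -> : (s n)^-1 * D n i j w ^+ 2 + s n * U n i a w ^+ 2 =
        (`|D n i j w| ^+ 2 + (s n * `|U n i a w|) ^+ 2) / s n.
      by rewrite exprMn !real_normK ?num_real//; field; rewrite gt_eqF//; exact: sh0.
    rewrite ler_pdivlMr; last exact: sh0.
    have := sqr_ge0 (`|D n i j w| - s n * `|U n i a w|).
    have := mulr_ge0 (normr_ge0 (D n i j w)) (mulr_ge0 (ltW (sh0 n)) (normr_ge0 (U n i a w))).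
    rewrite -/(s n); nra.
have DD : L1_null P (fun n w => T' n * \sum_i D n i k w * D n i l w).
  pose f n (i : 'I_n) w := D n i k w ^+ 2 + D n i l w ^+ 2.
  have f0 n i w : 0 <= f n i w by rewrite addr_ge0// sqr_ge0.
  have mf n i : measurable_fun setT (f n i).
    by apply: measurable_funD; exact: measurable_funX.
  apply: (@L1_null_dominated _ _ _ _ _ (fun n w => T' n * \sum_i f n i w)).
  - by move=> n; apply: mavg => i; exact: measurable_funM.
  - split; first by move=> n; exact: mavg.
    exists (fun n => 2 * C * h n).
      by rewrite -[X in _ --> X](mulr0 (2 * C)); apply: cvgM => //; exact: cvg_cst.
    move=> n n0; under eq_integral do rewrite ger0_norm ?avg_ge0//.
    rewrite -(Tn n (2 * C * h n) n0); apply: integral_avg_le => // i.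
    under eq_integral do rewrite EFinD.
    rewrite ge0_integralD//; last 4 first.
    - by move=> w _; rewrite lee_fin sqr_ge0.
    - by apply/measurable_EFinP; exact: measurable_funX.
    - by move=> w _; rewrite lee_fin sqr_ge0.
    - by apply/measurable_EFinP; exact: measurable_funX.
    have -> : h n * (2 * C * h n) = C * h n ^+ 2 + C * h n ^+ 2 by ring.
    by rewrite EFinD; apply: leeD; exact: momD.
  - move=> n w n0; rewrite [leRHS]ger0_norm ?avg_ge0//.
    rewrite normrM ger0_norm// ler_wpM2l// (le_trans (ler_norm_sum _ _ _))//.
    apply: ler_sum => i _; rewrite /f normrM.
    rewrite -(real_normK (num_real (D n i k w))) -(real_normK (num_real (D n i l w))).
    have := sqr_ge0 (`|D n i k w| - `|D n i l w|).
    have := mulr_ge0 (normr_ge0 (D n i k w)) (normr_ge0 (D n i l w)); nra.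
(* The centred sum has second moment at most [n%:R * (32 * h n ^+ 2)]; dividing by the square of
   [n%:R * h n] leaves [32 / n%:R]. *)
have UU a b : L1_null P (fun n w => T' n *
    \sum_i (U n i a w * U n i b w - (a == b)%:R * h n)).
  apply: (@L1_null_of_second_moment _ _ _ _ _ 32).
    move=> n; apply: mavg => i; apply: measurable_funB => //.
    exact: measurable_funM.
  move=> n n0.
  have [c mc cle] := noise_cov_second_moment a b (sh0 n) (mU n) (lawU n) (indepU n).
  rewrite shh in mc cle.
  exists (T' n ^+ 2 * c).
    by have := has_meanZ (T' n ^+ 2) mc; congr has_mean; apply/funext => w; rewrite exprMn.
  have -> : 32 / n%:R = T' n ^+ 2 * (n%:R * (32 * h n ^+ 2)).
    by rewrite /T'; field; rewrite !gt_eqF// ltr0n.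
  rewrite ler_wpM2l ?sqr_ge0//; move: cle.
  by rewrite -[4%N]/(2 * 2)%N exprM shh.
(* These null sequences add up to the error exactly for [n > 0], so the domination below is an
   equality. *)
have := L1_nullD (L1_nullD DD
  (L1_nullD (L1_null_sum (index_enum 'I_r) (fun a => L1_nullZ (S l a) (DU k a)))
            (L1_null_sum (index_enum 'I_r) (fun a => L1_nullZ (S k a) (DU l a)))))
  (L1_null_sum (index_enum 'I_r) (fun a =>
    L1_null_sum (index_enum 'I_r) (fun b => L1_nullZ (S k a * S l b) (UU a b)))).
move=> /L1_null_dominated; apply.
  move=> n; apply: measurable_funB => //; apply: mavg => i; apply: measurable_funM.
    by apply: measurable_funD => //; apply: measurable_sum => a; exact: measurable_funM.
  by apply: measurable_funD => //; apply: measurable_sum => a; exact: measurable_funM.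
move=> n w n0; rewrite le_eqVlt; apply/orP; left; apply/eqP; congr `|_|.
rewrite -/(T' n).
have pull (c : 'I_r -> R) (f : 'I_r -> 'I_n -> R) :
    \sum_a c a * (T' n * \sum_i f a i) = T' n * \sum_i \sum_a c a * f a i.
  rewrite exchange_big mulr_sumr; apply: eq_bigr => a _.
  by rewrite -mulr_sumr mulrCA.
(* Summed against [S k a * S l b] over [a], [b] and the [n] intervals, the centring terms contribute
   exactly [(S *m S^T) k l], which uses [n > 0]. *)
have noise : \sum_a \sum_b S k a * S l b *
      (T' n * \sum_i (U n i a w * U n i b w - (a == b)%:R * h n)) =
    T' n * (\sum_i (\sum_a S k a * U n i a w) * (\sum_b S l b * U n i b w))
    - (S *m S^T) k l.
  have -> : (S *m S^T) k l = T' n * \sum_(i < n) h n * (S *m S^T) k l.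
    by rewrite sumr_const card_ord -[X in T' n * X]mulr_natl Tn.
  rewrite -mulrBr -sumrB.
  transitivity (\sum_a S k a * (T' n * \sum_i (U n i a w * \sum_b S l b * U n i b w
      - h n * S l a))).
    apply: eq_bigr => a _; under eq_bigr do rewrite -mulrA.
    rewrite -mulr_sumr pull; congr (_ * (_ * _)); apply: eq_bigr => i _.
    under eq_bigr do rewrite mulrBr; rewrite sumrB; congr (_ - _).
      by rewrite mulr_sumr; apply: eq_bigr => b _; rewrite mulrCA.
    rewrite (bigD1 a)//= eqxx mul1r big1 ?addr0 1?mulrC// => b ba.
    by rewrite eq_sym (negbTE ba) mul0r mulr0.
  rewrite pull; congr (_ * _); apply: eq_bigr => i _.
  under eq_bigr do rewrite mulrBr; rewrite sumrB; congr (_ - _).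
    by rewrite mulr_suml; apply: eq_bigr => a _; rewrite mulrA.
  by rewrite mxE mulr_sumr; apply: eq_bigr => a _; rewrite !mxE mulrCA.
rewrite noise !pull addrA; congr (_ - _); rewrite -!mulrDr -!big_split/=.
congr (_ * _); apply: eq_bigr => i _.
have E1 : \sum_a S l a * (D n i k w * U n i a w) = D n i k w * \sum_a S l a * U n i a w.
  by rewrite mulr_sumr; apply: eq_bigr => a _; rewrite mulrCA.
have E2 : \sum_a S k a * (D n i l w * U n i a w) = D n i l w * \sum_a S k a * U n i a w.
  by rewrite mulr_sumr; apply: eq_bigr => a _; rewrite mulrCA.
by rewrite E1 E2; ring.
Qed.

(** * The noise driving the observed process *)

Lemma sigma_process_increment {R : realType} {dO : measure_display}
    {Omega : measurableType dO} {d : nat} (W : R -> Omega -> 'cV[R]_d)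
    (s t : R) (j : 'I_d) (A : set Omega) :
  0 <= s -> 0 <= t ->
  preimage_set_system setT (fun w => W t w j 0 - W s w j 0)
    (@measurable _ R) A -> sigma_process W A.
Proof.
move=> s0 t0 [B mB <-].
pose G := \bigcup_(t in [set t : R | 0 <= t])
  preimage_set_system [set: Omega] (W t) (@measurable _ (borelType 'cV[R]_d)).
have mW u : 0 <= u -> @measurable_fun _ _ (g_sigma_algebraType G) (borelType 'cV[R]_d) setT (W u).
  move=> u0 _ V mV; apply: sub_sigma_algebra; exists u => //.
  by exists V.
have mWj u : 0 <= u -> @measurable_fun _ _ (g_sigma_algebraType G) R setT (fun w => W u w j 0).
  by move=> u0; exact: measurable_mx_coord (mW u u0).
exact: (measurable_funB (mWj t t0) (mWj s s0) measurableT mB).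
Qed.

Lemma sigma_process_fin_bigcap {R : realType} {dO : measure_display}
    {Omega : measurableType dO} {d : nat} (W : R -> Omega -> 'cV[R]_d)
    (I : finType) (A : I -> set Omega) :
  (forall i, sigma_process W (A i)) -> sigma_process W (\bigcap_(i in [set: I]) A i).
Proof.
move=> WA; pose G := \bigcup_(t in [set t : R | 0 <= t])
  preimage_set_system [set: Omega] (W t) (@measurable _ (borelType 'cV[R]_d)).
have := @fin_bigcap_measurable _ (g_sigma_algebraType G) I [set: I] A.
by apply => // i _; exact: WA.
Qed.

(** Independence of the four processes factors the probability over [B1] to [B4], each of which
    depends on one process; independence of the increments within that process factors it
    further. *)
Lemma joint_noise_independent {R : realType} {dO : measure_display}
    {Omega : measurableType dO} (P : probability Omega R) {r1 r2 r3 r4 n : nat}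
    (W1 : R -> Omega -> 'cV[R]_r1) (W2 : R -> Omega -> 'cV[R]_r2)
    (W3 : R -> Omega -> 'cV[R]_r3) (W4 : R -> Omega -> 'cV[R]_r4) (t : nat -> R) :
  wiener P W1 -> wiener P W2 -> wiener P W3 -> wiener P W4 ->
  independent P (tnth [tuple sigma_process W1; sigma_process W2;
                             sigma_process W3; sigma_process W4]) ->
  0 <= t 0%N -> (forall i, t i <= t i.+1) ->
  let W u w := col_mx (W1 u w) (col_mx (W2 u w) (col_mx (W3 u w) (W4 u w))) in
  independent P (fun u : 'I_n * 'I_(r1 + (r2 + (r3 + r4))) =>
    preimage_set_system setT (fun w => W (t u.1.+1) w u.2 0 - W (t u.1) w u.2 0)
      (@measurable _ R)).
Proof.
move=> w1 w2 w3 w4 indepW t0 tS W A AP.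
have tge0 i : 0 <= t i.
  by elim: i => // i /le_trans; apply.
pose B1 := \bigcap_(u in [set: 'I_n * 'I_r1]) A (u.1, lshift _ u.2).
pose B2 := \bigcap_(u in [set: 'I_n * 'I_r2]) A (u.1, rshift _ (lshift _ u.2)).
pose B3 := \bigcap_(u in [set: 'I_n * 'I_r3]) A (u.1, rshift _ (rshift _ (lshift _ u.2))).
pose B4 := \bigcap_(u in [set: 'I_n * 'I_r4]) A (u.1, rshift _ (rshift _ (rshift _ u.2))).
have AP1 (u : 'I_n * 'I_r1) : preimage_set_system setT
    (fun w => W1 (t u.1.+1) w u.2 0 - W1 (t u.1) w u.2 0) (@measurable _ R)
    (A (u.1, lshift _ u.2)).
  have := AP (u.1, lshift _ u.2); congr preimage_set_system.
  by apply/funext => w; rewrite /W !col_mxEu.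
have AP2 (u : 'I_n * 'I_r2) : preimage_set_system setT
    (fun w => W2 (t u.1.+1) w u.2 0 - W2 (t u.1) w u.2 0) (@measurable _ R)
    (A (u.1, rshift _ (lshift _ u.2))).
  have := AP (u.1, rshift _ (lshift _ u.2)); congr preimage_set_system.
  by apply/funext => w; rewrite /W !col_mxEd !col_mxEu.
have AP3 (u : 'I_n * 'I_r3) : preimage_set_system setT
    (fun w => W3 (t u.1.+1) w u.2 0 - W3 (t u.1) w u.2 0) (@measurable _ R)
    (A (u.1, rshift _ (rshift _ (lshift _ u.2)))).
  have := AP (u.1, rshift _ (rshift _ (lshift _ u.2))); congr preimage_set_system.
  by apply/funext => w; rewrite /W !col_mxEd !col_mxEu.
have AP4 (u : 'I_n * 'I_r4) : preimage_set_system setT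
    (fun w => W4 (t u.1.+1) w u.2 0 - W4 (t u.1) w u.2 0) (@measurable _ R)
    (A (u.1, rshift _ (rshift _ (rshift _ u.2)))).
  have := AP (u.1, rshift _ (rshift _ (rshift _ u.2))); congr preimage_set_system.
  by apply/funext => w; rewrite /W !col_mxEd.
have PB1 : P B1 = (\prod_u P (A (u.1, lshift _ u.2)))%E.
  exact: (wiener_independent w1 t0 tS AP1).
have PB2 : P B2 = (\prod_u P (A (u.1, rshift _ (lshift _ u.2))))%E.
  exact: (wiener_independent w2 t0 tS AP2).
have PB3 : P B3 = (\prod_u P (A (u.1, rshift _ (rshift _ (lshift _ u.2)))))%E.
  exact: (wiener_independent w3 t0 tS AP3).
have PB4 : P B4 = (\prod_u P (A (u.1, rshift _ (rshift _ (rshift _ u.2)))))%E.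
  exact: (wiener_independent w4 t0 tS AP4).
have BP i : tnth [tuple sigma_process W1; sigma_process W2;
                        sigma_process W3; sigma_process W4] i (tnth [tuple B1; B2; B3; B4] i).
  case: i => -[|[|[|[|//]]]] i4; rewrite !(tnth_nth set0)/=;
    apply: sigma_process_fin_bigcap => u;
    [have := AP1 u|have := AP2 u|have := AP3 u|have := AP4 u];
    exact: sigma_process_increment.
have := indepW _ BP; rewrite !big_ord_recl big_ord0 !(tnth_nth set0)/= mule1.
rewrite PB1 PB2 PB3 PB4.
have -> : \bigcap_(i in [set: 'I_4]) tnth [tuple B1; B2; B3; B4] i = \bigcap_(u in setT) A u.
  apply/seteqP; split => w Aw.
    move=> [i a] _.
    have Bw (k : 'I_4) : tnth [tuple B1; B2; B3; B4] k w by exact: Aw.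
    case: (split_ordP a) => b ->.
      by have := Bw (inord 0); rewrite (tnth_nth set0) inordK//= => /(_ (i, b) I).
    case: (split_ordP b) => c ->.
      by have := Bw (inord 1); rewrite (tnth_nth set0) inordK//= => /(_ (i, c) I).
    case: (split_ordP c) => e ->.
      by have := Bw (inord 2); rewrite (tnth_nth set0) inordK//= => /(_ (i, e) I).
    by have := Bw (inord 3); rewrite (tnth_nth set0) inordK//= => /(_ (i, e) I).
  by move=> [[|[|[|[|//]]]] i4] _; rewrite (tnth_nth set0)/= => u _; exact: Aw.
move=> ->.
transitivity (\prod_i \prod_a P (A (i, a)))%E; last first.
  by rewrite pair_bigA; apply: eq_bigr => -[].
under [RHS]eq_bigr do rewrite !big_split_ord/=.
by rewrite !big_split/= !pair_bigA.
Qed.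

(** Abstracts the drift part of an increment over [[s, s + l]]. The property is stable under linear
    combinations, which carries it from the latent processes to the observed one. *)
Definition quadratic_drift {R : realType} {d : measure_display}
    {T : measurableType d} (P : {measure set T -> \bar R})
    (F : R -> R -> T -> R) : Prop :=
  exists2 C : R, 0 <= C & forall s l, 0 <= s -> 0 < l ->
    measurable_fun setT (F s l) /\
    (\int[P]_w (F s l w ^+ 2)%:E <= (C * l ^+ 2)%:E)%E.

Lemma quadratic_driftD {R : realType} {d : measure_display}
    {T : measurableType d} (P : {measure set T -> \bar R}) (F G : R -> R -> T -> R) :
  quadratic_drift P F -> quadratic_drift P G ->
  quadratic_drift P (fun s l w => F s l w + G s l w).
Proof.
move=> [C C0 FC] [D D0 GD]; exists (2 * C + 2 * D); first by rewrite addr_ge0// mulr_ge0.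
move=> s l s0 l0; have [mF Fle] := FC s l s0 l0; have [mG Gle] := GD s l s0 l0.
split; first exact: measurable_funD.
have mF2 : measurable_fun setT (fun w => (F s l w ^+ 2)%:E).
  by apply/measurable_EFinP; exact: measurable_funX.
have mG2 : measurable_fun setT (fun w => (G s l w ^+ 2)%:E).
  by apply/measurable_EFinP; exact: measurable_funX.
apply: (@le_trans _ _ (\int[P]_w (2%:E * (F s l w ^+ 2)%:E + 2%:E * (G s l w ^+ 2)%:E))%E).
  apply: ge0_le_integral => //.
  - by move=> w _; rewrite lee_fin sqr_ge0.
  - by apply/measurable_EFinP; apply: measurable_funX; exact: measurable_funD.
  - by apply: emeasurable_funD; exact: measurable_funeM.
  - move=> w _; rewrite -!EFinM -EFinD lee_fin.
    have := sqr_ge0 (F s l w - G s l w); nra.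
have sq0 (x : R) : (0 <= (x ^+ 2)%:E)%E by rewrite lee_fin sqr_ge0.
rewrite ge0_integralD//; last 4 first.
- by move=> w _; rewrite mule_ge0.
- exact: measurable_funeM.
- by move=> w _; rewrite mule_ge0.
- exact: measurable_funeM.
have two0 : (0 <= 2%:E :> \bar R)%E by rewrite lee_fin.
rewrite !ge0_integralZl//.
have -> : ((2 * C + 2 * D) * l ^+ 2)%:E =
    (2%:E * (C * l ^+ 2)%:E + 2%:E * (D * l ^+ 2)%:E)%E.
  by rewrite -!EFinM -EFinD; congr EFin; ring.
by apply: leeD; apply: lee_wpmul2l.
Qed.

Lemma quadratic_driftZ {R : realType} {d : measure_display}
    {T : measurableType d} (P : {measure set T -> \bar R}) (F : R -> R -> T -> R) (a : R) :
  quadratic_drift P F -> quadratic_drift P (fun s l w => a * F s l w).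
Proof.
move=> [C C0 FC]; exists (a ^+ 2 * C); first by rewrite mulr_ge0// sqr_ge0.
move=> s l s0 l0; have [mF Fle] := FC s l s0 l0.
split; first exact: measurable_funM.
have mF2 : measurable_fun setT (fun w => (F s l w ^+ 2)%:E).
  by apply/measurable_EFinP; exact: measurable_funX.
under eq_integral do rewrite exprMn (EFinM (a ^+ 2)).
have a2 : (0 <= (a ^+ 2)%:E)%E by rewrite lee_fin sqr_ge0.
rewrite ge0_integralZl//; last by move=> w _; rewrite lee_fin sqr_ge0.
by rewrite -mulrA [X in (_ <= X)%E]EFinM; apply: lee_wpmul2l.
Qed.

Lemma quadratic_drift_sum {R : realType} {d : measure_display}
    {T : measurableType d} (P : {measure set T -> \bar R}) (I : Type) (r : seq I)
    (F : I -> R -> R -> T -> R) :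
  (forall i, quadratic_drift P (F i)) ->
  quadratic_drift P (fun s l w => \sum_(i <- r) F i s l w).
Proof.
move=> FP; elim: r => [|i r IH].
  exists 0 => // s l s0 l0; split.
    under eq_fun do rewrite big_nil; exact: measurable_cst.
  under eq_integral do rewrite big_nil expr0n/=.
  by rewrite integral0 mul0r.
have := quadratic_driftD (FP i) IH; congr quadratic_drift.
by apply/funext => s; apply/funext => l; apply/funext => w; rewrite big_cons.
Qed.

Lemma quadratic_drift_mulmx {R : realType} {dO : measure_display}
    {Omega : measurableType dO} (P : probability Omega R) {p d r : nat}
    (B : 'cV[R]_d -> 'cV[R]_d) (S : 'M[R]_(d, r)) (W : R -> Omega -> 'cV[R]_r)
    (c : 'cV[R]_d) (Y : R -> Omega -> 'cV[R]_d) (A : 'M[R]_(p, d)) (k : 'I_p) :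
  wiener P W -> sde_solution P B S W c Y -> regular_drift B -> bounded_moments P Y ->
  quadratic_drift P (fun s l w =>
    (A *m (Y (s + l) w - Y s w - S *m (W (s + l) w - W s w))) k 0).
Proof.
move=> wW solY regB momY.
have [C C0 CP] := drift_second_moment (wiener_measurable wW) solY regB momY.
have : quadratic_drift P (fun s l w => \sum_i A k i *
    (Y (s + l) w - Y s w - S *m (W (s + l) w - W s w)) i 0).
  apply: quadratic_drift_sum => i; apply: quadratic_driftZ.
  by exists C => // s l s0 l0; exact: CP.
congr quadratic_drift.
by apply/funext => s; apply/funext => l; apply/funext => w; rewrite [RHS]mxE.
Qed.

(** * Tail bounds and measurability of the contrast *)

Lemma L1_null_markov {R : realType} {d : measure_display} {T : measurableType d}
    (P : probability T R) (Z : nat -> T -> R) (e : R) :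
  L1_null P Z -> 0 < e -> exists2 u : nat -> R, u n @[n --> \oo] --> 0 &
    forall n, (0 < n)%N -> (P [set w | (e <= `|Z n w|)%R] <= (u n)%:E)%E.
Proof.
move=> [mZ [u u0 uP]] e0; exists (fun n => e^-1 * u n).
  by rewrite -[X in _ --> X](mulr0 e^-1); apply: cvgM => //; exact: cvg_cst.
move=> n n0.
have mabs : measurable_fun setT (fun w => `|Z n w|) by exact: measurableT_comp.
have mA : measurable [set w | (e <= `|Z n w|)%R].
  rewrite -[X in measurable X]setTI.
  have := measurable_fun_ler (measurable_cst e) mabs.
  by move=> /(_ measurableT [set true]); apply.
have ei : (0 <= (e^-1)%:E)%E by rewrite lee_fin invr_ge0 ltW.
rewrite EFinM; apply: le_trans (lee_wpmul2l ei (uP n n0)).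
rewrite -ge0_integralZl//; last exact/measurable_EFinP.
rewrite -[X in P X]setIT -integral_indic//.
apply: ge0_le_integral => //.
- by apply/measurable_EFinP; exact: measurable_indic.
- by apply: measurable_funeM; exact/measurable_EFinP.
- move=> w _; rewrite -EFinM lee_fin indicE; case: (boolP (w \in _)) => [/set_mem/= ew|_] /=.
    by rewrite ler_pdivlMl// mulr1.
  by rewrite mulr_ge0// invr_ge0 ltW.
Qed.

(** With [S] invertible everywhere, [Fdisc] is measurable on the whole space, singular [Q] included,
    so the two branches are glued along the measurable set where the determinant of [Q] vanishes. *)
Lemma measurable_contrast {R : realType} {d : measure_display} {T : measurableType d}
    {p : nat} (Q S : T -> 'M[R]_p) :
  (forall i j, measurable_fun setT (fun t => Q t i j)) ->
  (forall i j, measurable_fun setT (fun t => S t i j)) ->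
  (forall t, S t \in unitmx) ->
  measurable_fun setT (fun t => contrast (Q t) (S t)).
Proof.
move=> mQ mS Su; have FC := @function_algebra_measurable R d T.
have mdetQ := mx_in_det FC mQ; have mdetS := mx_in_det FC mS.
apply: measurable_fun_ifT.
- rewrite (_ : (fun t => Q t \in unitmx) = (fun t => ~~ (\det (Q t) == 0))); last first.
    by apply/funext => t; rewrite unitmxE unitfE.
  by apply: measurable_neg; apply: measurable_fun_eqr => //; exact: measurable_cst.
- apply: (fa_Fdisc FC) => //.
  + by apply: measurableT_comp mdetQ; exact: measurable_ln.
  + by apply: measurableT_comp mdetS; exact: measurable_ln.
- rewrite (_ : (fun t => _) = (fun t => \sum_i (vech (Q t) - vech (S t)) i 0 ^+ 2)).
    apply: measurable_sum => i; apply: measurable_funX.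
    rewrite (_ : (fun t => _) = (fun t => Q t (enum_val i).2 (enum_val i).1
        - S t (enum_val i).2 (enum_val i).1)); last by apply/funext => t; rewrite !mxE.
    exact: measurable_funB.
  by apply/funext => t; rewrite sqr_sqrtr// sumr_ge0// => i _; exact: sqr_ge0.
Qed.

Lemma psd_mulmx_tr {R : realType} {n k : nat} (A : 'M[R]_(n, k)) : psd (A *m A^T).
Proof.
split; first by rewrite trmx_mul trmxK.
move=> v; have -> : v^T *m (A *m A^T) *m v = (A^T *m v)^T *m (A^T *m v).
  by rewrite trmx_mul trmxK !mulmxA.
by rewrite mxE sumr_ge0// => i _; rewrite mxE -expr2 sqr_ge0.
Qed.

(** * Consistency of the test *)

Unset Implicit Arguments.
Set Strict Implicit.

Theorem theorem8 (R : realType)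
  (* dimensions *)
  (p1 p2 k1 k2 r1 r2 r3 r4 q : nat)
  (hp1 : (1 <= p1)%N) (hp2 : (1 <= p2)%N)
  (hk1 : (1 <= k1)%N) (hk2 : (1 <= k2)%N)
  (hr1 : (1 <= r1)%N) (hr2 : (1 <= r2)%N)
  (hr3 : (1 <= r3)%N) (hr4 : (1 <= r4)%N)
  (hkp1 : (k1 <= p1)%N) (hkp2 : (k2 <= p2)%N)
  (hdf : (q < ((p1 + p2) * (p1 + p2).+1)./2)%N)
  (* driving noise *)
  (dO : measure_display) (Omega : measurableType dO) (P : probability Omega R)
  (W1 : R -> Omega -> 'cV[R]_r1) (W2 : R -> Omega -> 'cV[R]_r2)
  (W3 : R -> Omega -> 'cV[R]_r3) (W4 : R -> Omega -> 'cV[R]_r4)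
  (hW1 : wiener P W1) (hW2 : wiener P W2)
  (hW3 : wiener P W3) (hW4 : wiener P W4)
  (hWind : independent P (tnth [tuple sigma_process W1; sigma_process W2;
                                      sigma_process W3; sigma_process W4]))
  (* latent processes *)
  (B1 : 'cV[R]_k1 -> 'cV[R]_k1) (B2 : 'cV[R]_p1 -> 'cV[R]_p1)
  (B3 : 'cV[R]_p2 -> 'cV[R]_p2) (B4 : 'cV[R]_k2 -> 'cV[R]_k2)
  (S1 : 'M[R]_(k1, r1)) (S2 : 'M[R]_(p1, r2))
  (S3 : 'M[R]_(p2, r3)) (S4 : 'M[R]_(k2, r4))
  (c1 : 'cV[R]_k1) (c2 : 'cV[R]_p1) (c3 : 'cV[R]_p2) (c4 : 'cV[R]_k2)
  (xi : R -> Omega -> 'cV[R]_k1) (delta : R -> Omega -> 'cV[R]_p1)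
  (eps : R -> Omega -> 'cV[R]_p2) (zeta : R -> Omega -> 'cV[R]_k2)
  (hxi : sde_solution P B1 S1 W1 c1 xi)
  (hdelta : sde_solution P B2 S2 W2 c2 delta)
  (heps : sde_solution P B3 S3 W3 c3 eps)
  (hzeta : sde_solution P B4 S4 W4 c4 zeta)
  (hS2 : posdef (S2 *m S2^T)) (hS3 : posdef (S3 *m S3^T))
  (* true structural matrices and observed process *)
  (L10 : 'M[R]_(p1, k1)) (L20 : 'M[R]_(p2, k2)) (G0 : 'M[R]_(k2, k1))
  (Bmx0 : 'M[R]_k2)
  (hL10 : \rank L10 = k1) (hBmx0 : forall i, Bmx0 i i = 0)
  (hPsi0 : 1%:M - Bmx0 \in unitmx)
  (eta : R -> Omega -> 'cV[R]_k2)
  (heta : forall (t : R) (w : Omega), 0 <= t ->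
     eta t w = Bmx0 *m eta t w + G0 *m xi t w + zeta t w)
  (* parametric model *)
  (Theta : set 'rV[R]_q)
  (hconv : convex_set (Theta : set (convex_lmodType 'rV[R]_q)))
  (hcomp : compact Theta)
  (M : sem (R + 'I_q) p1 p2 k1 k2)
  (hocc : forall i : 'I_q, sem_occurs i M)
  (hadm : forall theta, Theta theta -> sem_admissible (sem_at M theta))
  (* sampling scheme and level *)
  (h : nat -> R) (hh : forall n, 0 < h n)
  (alpha : R) (halpha0 : 0 < alpha) (halpha1 : alpha < 1)
  (* assumptions on the latent processes *)
  (hB1 : regular_drift B1) (hB2 : regular_drift B2)
  (hB3 : regular_drift B3) (hB4 : regular_drift B4)
  (hmom1 : bounded_moments P xi) (hmom2 : bounded_moments P delta)
  (hmom3 : bounded_moments P eps) (hmom4 : bounded_moments P zeta)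
  (herg1 : ergodic P B1 S1 W1 xi) (herg2 : ergodic P B2 S2 W2 delta)
  (herg3 : ergodic P B3 S3 W3 eps) (herg4 : ergodic P B4 S4 W4 zeta) :
  let Sigma0 : 'M[R]_(p1 + p2) :=
    sem_cov (Sem L10 L20 G0 (1%:M - Bmx0)
                 (S1 *m S1^T) (S2 *m S2^T) (S3 *m S3^T) (S4 *m S4^T)) in
  let Sigma (theta : 'rV[R]_q) : 'M[R]_(p1 + p2) :=
    sem_cov (sem_at M theta) in
  let Q := realized_cov (observed L10 L20 xi delta eta eps) h in
  let F (n : nat) (w : Omega) (theta : 'rV[R]_q) : R :=
    contrast (Q n w) (Sigma theta) in
  forall (hatTheta : nat -> Omega -> 'rV[R]_q)
    (hatTheta_meas : forall n, @measurable_fun _ _ Omega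
       (borelType 'rV[R]_q) [set: Omega] (hatTheta n))
    (hatTheta_in : forall n w, Theta (hatTheta n w))
    (hatTheta_min : forall n w, (0 < n)%N ->
       F n w (hatTheta n w) = inf [set F n w theta | theta in Theta])
    (H1 : forall theta, Theta theta -> Sigma0 <> Sigma theta)
    (hU : exists! thetabar : 'rV[R]_q,
       is_minimizer Theta (fun theta => Fdisc Sigma0 (Sigma theta)) thetabar)
    (hh0 : h n @[n --> \oo] --> 0)
    (hnh : n%:R * h n @[n --> \oo] --> +oo),
  P [set w | chi2_upper (((p1 + p2) * (p1 + p2).+1)./2 - q) alpha
               < n%:R * F n w (hatTheta n w)] @[n --> \oo] --> 1%E.
Proof.
move=> Sigma0 Sigma Q F hatTheta mhat hatTheta_in _ H1 _ hh0 _.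
pose m0 := Sem L10 L20 G0 (1%:M - Bmx0) (S1 *m S1^T) (S2 *m S2^T) (S3 *m S3^T) (S4 *m S4^T).
pose A1 := load_xi m0; pose A4 := load_zeta m0.
pose A2 : 'M[R]_(p1 + p2, p1) := col_mx 1%:M 0.
pose A3 : 'M[R]_(p1 + p2, p2) := col_mx 0 1%:M.
pose X := observed L10 L20 xi delta eta eps.
(* Reduced form: eliminating [eta] through the inverse of [1%:M - Bmx0] exhibits the observed
   process as a linear image of the four latent ones. *)
have XE t w : 0 <= t -> X t w = A1 *m xi t w + A2 *m delta t w + A3 *m eps t w + A4 *m zeta t w.
  move=> t0; have etaE : eta t w = invmx (1%:M - Bmx0) *m (G0 *m xi t w + zeta t w).
    apply: (can_inj (mulKmx hPsi0)); rewrite mulKVmx// mulmxBl mul1mx.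
    by apply/eqP; rewrite subr_eq; apply/eqP; rewrite {1}heta// -addrA addrC.
  rewrite /X /observed etaE /A1 /A2 /A3 /A4 /load_xi /load_zeta /=.
  rewrite !mul_col_mx !mul0mx !mul1mx !add_col_mx !addr0; congr col_mx.
  by rewrite !mulmxDr !mulmxA addrAC.
(* The diffusion coefficient of the observed process with respect to the stacked noise [W]; the
   decomposition of [sem_cov] into congruences gives [S *m S^T = Sigma0]. *)
pose S := row_mx (A1 *m S1) (row_mx (A2 *m S2) (row_mx (A3 *m S3) (A4 *m S4))).
have Sigma0E : Sigma0 = S *m S^T.
  rewrite /Sigma0 sem_covE /=; last by rewrite trmx_mul trmxK.
  rewrite /S !tr_row_mx !mul_row_col !trmx_mul !mulmxA -/m0 -/A1 -/A4 -!addrA.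
  congr (_ + _); rewrite addrA; congr (_ + _).
  rewrite /A2 /A3 !mul_col_mx !tr_col_mx !mul_mx_row -!/(block_mx _ _ _ _).
  by rewrite !trmx0 !trmx1 !mulmx0 !mul0mx !mulmx1 !mul1mx add_block_mx !addr0 !add0r.
pose W (u : R) w := col_mx (W1 u w) (col_mx (W2 u w) (col_mx (W3 u w) (W4 u w))).
(* What is left of coordinate [k] of an observed increment once its noise part is removed. *)
pose Dr k (s l : R) w := (A1 *m (xi (s + l) w - xi s w - S1 *m (W1 (s + l) w - W1 s w))) k 0
  + (A2 *m (delta (s + l) w - delta s w - S2 *m (W2 (s + l) w - W2 s w))) k 0
  + (A3 *m (eps (s + l) w - eps s w - S3 *m (W3 (s + l) w - W3 s w))) k 0
  + (A4 *m (zeta (s + l) w - zeta s w - S4 *m (W4 (s + l) w - W4 s w))) k 0.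
have /choice[C CP] : forall k, exists C, 0 <= C /\ forall s l, 0 <= s -> 0 < l ->
    measurable_fun setT (Dr k s l) /\
    (\int[P]_w (Dr k s l w ^+ 2)%:E <= (C * l ^+ 2)%:E)%E.
  move=> k; have [C C0 CP] := quadratic_driftD (quadratic_driftD (quadratic_driftD
    (quadratic_drift_mulmx A1 k hW1 hxi hB1 hmom1)
    (quadratic_drift_mulmx A2 k hW2 hdelta hB2 hmom2))
    (quadratic_drift_mulmx A3 k hW3 heps hB3 hmom3))
    (quadratic_drift_mulmx A4 k hW4 hzeta hB4 hmom4).
  by exists C.
have th0 n (i : nat) : 0 <= i%:R * h n by rewrite mulr_ge0// ltW.
have thS n (i : nat) : i.+1%:R * h n = i%:R * h n + h n by rewrite -natr1 mulrDl mul1r.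
pose U n (i : 'I_n) a w := W (i.+1%:R * h n) w a 0 - W (i%:R * h n) w a 0.
pose D n (i : 'I_n) k w := Dr k (i%:R * h n) (h n) w.
have dXE n (i : 'I_n) k w : (X (i.+1%:R * h n) w - X (i%:R * h n) w) k 0 =
    D n i k w + \sum_a S k a * U n i a w.
  have -> : \sum_a S k a * U n i a w =
      (S *m (W (i.+1%:R * h n) w - W (i%:R * h n) w)) k 0.
    by rewrite [RHS]mxE; apply: eq_bigr => a _; rewrite /U !mxE.
  have mxD (a b : 'cV[R]_(p1 + p2)) : (a + b) k 0 = a k 0 + b k 0 by rewrite mxE.
  have mxN (a : 'cV[R]_(p1 + p2)) : (- a) k 0 = - a k 0 by rewrite mxE.
  rewrite /D /Dr -thS mxD mxN !XE// /S /W !opp_col_mx !add_col_mx !mul_row_col.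
  by rewrite !mulmxBr !mulmxA !(mxD, mxN); ring.
have Wlaw n (i : 'I_n) a B : measurable B ->
    P (U n i a @^-1` B) = normal_prob 0 (Num.sqrt (h n)) B.
  move=> mB; have hE : i.+1%:R * h n - i%:R * h n = h n by rewrite thS addrAC subrr add0r.
  have lt : i%:R * h n < i.+1%:R * h n by rewrite thS ltrDl.
  rewrite /U /W; case: (split_ordP a) => b ->.
    rewrite (_ : (fun w => _) = (fun w => W1 (i.+1%:R * h n) w b 0 - W1 (i%:R * h n) w b 0));
      last by apply/funext => w; rewrite !col_mxEu.
    by have := wiener_increment hW1 b (th0 n i) lt mB; rewrite hE.
  case: (split_ordP b) => c ->.
    rewrite (_ : (fun w => _) = (fun w => W2 (i.+1%:R * h n) w c 0 - W2 (i%:R * h n) w c 0));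
      last by apply/funext => w; rewrite !col_mxEd !col_mxEu.
    by have := wiener_increment hW2 c (th0 n i) lt mB; rewrite hE.
  case: (split_ordP c) => e ->.
    rewrite (_ : (fun w => _) = (fun w => W3 (i.+1%:R * h n) w e 0 - W3 (i%:R * h n) w e 0));
      last by apply/funext => w; rewrite !col_mxEd !col_mxEu.
    by have := wiener_increment hW3 e (th0 n i) lt mB; rewrite hE.
  rewrite (_ : (fun w => _) = (fun w => W4 (i.+1%:R * h n) w e 0 - W4 (i%:R * h n) w e 0));
    last by apply/funext => w; rewrite !col_mxEd.
  by have := wiener_increment hW4 e (th0 n i) lt mB; rewrite hE.
have mU n (i : 'I_n) a : measurable_fun setT (U n i a).
  have mW1 := wiener_measurable hW1; have mW2 := wiener_measurable hW2.
  have mW3 := wiener_measurable hW3; have mW4 := wiener_measurable hW4.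
  have mWt (t : R) : 0 <= t -> measurable_fun setT (fun w => W t w a 0).
    move=> t0; rewrite /W; case: (split_ordP a) => b ->.
      under eq_fun do rewrite col_mxEu; exact: measurable_mx_coord (mW1 t t0).
    case: (split_ordP b) => c ->.
      under eq_fun do rewrite col_mxEd col_mxEu; exact: measurable_mx_coord (mW2 t t0).
    case: (split_ordP c) => e ->.
      under eq_fun do rewrite !col_mxEd col_mxEu; exact: measurable_mx_coord (mW3 t t0).
    under eq_fun do rewrite !col_mxEd; exact: measurable_mx_coord (mW4 t t0).
  by apply: measurable_funB; exact: mWt.
have mD n (i : 'I_n) k : measurable_fun setT (D n i k).
  exact: ((CP k).2 _ _ (th0 n i) (hh n)).1.
have QE n w k l : Q n w k l = (n%:R * h n)^-1 *
    \sum_i (D n i k w + \sum_a S k a * U n i a w) * (D n i l w + \sum_a S l a * U n i a w).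
  rewrite /Q /realized_cov mxE summxE; congr (_ * _); apply: eq_bigr => i _.
  rewrite mxE big_ord1 -!dXE; congr (_ * _); by rewrite mxE.
have Qcvg k l : L1_null P (fun n w => Q n w k l - Sigma0 k l).
  have := @quadratic_variation_L1 _ _ _ P _ _ h D U S (\sum_k C k) hh hh0.
  have -> : (fun n w => Q n w k l - Sigma0 k l) = (fun n w => (n%:R * h n)^-1 *
      (\sum_i (D n i k w + \sum_a S k a * U n i a w) *
              (D n i l w + \sum_a S l a * U n i a w)) - (S *m S^T) k l).
    by apply/funext => n; apply/funext => w; rewrite QE Sigma0E.
  apply => //.
  - by apply: sumr_ge0 => j _; exact: (CP j).1.
  - move=> n i j; apply: le_trans ((CP j).2 _ _ (th0 n i) (hh n)).2 _.
    rewrite lee_fin ler_wpM2r ?sqr_ge0// (bigD1 j)//= lerDl sumr_ge0// => j' _.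
    exact: (CP j').1.
  - move=> n; apply: (@joint_noise_independent _ _ _ P _ _ _ _ n W1 W2 W3 W4
      (fun i => i%:R * h n)) => //.
    by move=> i; rewrite thS lerDl ltW.
have mQ n k l : measurable_fun setT (fun w => Q n w k l).
  under eq_fun do rewrite QE.
  apply: measurable_funM => //; apply: measurable_sum => i; apply: measurable_funM;
    apply: measurable_funD => //; apply: measurable_sum => a; exact: measurable_funM.
have Sigma0pd : posdef Sigma0.
  by apply: sem_cov_posdef => //=; exact: psd_mulmx_tr.
have [e [e0 [c [c0 cP]]]] := contrast_bounded_below hcomp hadm Sigma0pd H1.
set chi := chi2_upper _ _.
(* The entries of [Sigma] at the estimator are measurable functions of a measurable variable, and
   [Sigma] is invertible on [Theta], where the estimator takes its values. *)
have mE n : measurable [set w | chi < n%:R * F n w (hatTheta n w)].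
  have mF : measurable_fun setT (fun w => F n w (hatTheta n w)).
    apply: measurable_contrast => //.
      apply: (fa_sem_cov (C := fun f => measurable_fun setT f) function_algebra_measurable).
        move=> i j; exact: measurable_mx_coord (mhat n).
      by move=> w _; have [[_ _ Pu] _] := hadm _ (hatTheta_in n w).
    move=> w; have [_ [? ? ? ?]] := hadm _ (hatTheta_in n w).
    by rewrite unitmxE unitfE gt_eqF// posdef_det_gt0//; exact: sem_cov_posdef.
  rewrite -[X in measurable X]setTI.
  have mlt : measurable_fun setT (fun w => chi < n%:R * F n w (hatTheta n w)).
    by apply: measurable_fun_ltr => //; exact: measurable_funM.
  exact: (mlt measurableT [set true]).
(* Summing the absolute errors lets one application of Markov's inequality control all entries
   simultaneously. *)
have Zcvg : L1_null P (fun n w => \sum_k \sum_l `|Q n w k l - Sigma0 k l|).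
  apply: L1_null_sum => k; apply: L1_null_sum => l.
  apply: L1_null_dominated (Qcvg k l) _ => [n|n w _]; last by rewrite normr_id.
  by apply: measurableT_comp => //; apply: measurable_funB.
have [u u0 uP] := L1_null_markov Zcvg e0.
have large : \forall n \near \oo, chi < n%:R * c.
  have := nbhs_infty_gtr (chi / c); apply: filterS => n.
  by rewrite ltr_pdivrMr.
(* For all large [n] the probability lies between [1 - u n] and 1. *)
apply: (@squeeze_cvge _ _ _ _ (fun n => (1 - u n)%:E) _ (fun=> 1%E)); last 2 first.
- apply: cvg_EFin; first exact: nearW.
  by rewrite -[X in _ --> X]subr0; apply: cvgB => //; exact: cvg_cst.
- exact: cvg_cst.
have n0 : \forall n \near \oo, (0 < n)%N by exact: nbhs_infty_gt.
apply: filterS2 large n0 => n nc n0; apply/andP; split; last exact: probability_le1.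
set bad := [set w | (e <= `|\sum_k \sum_l `|Q n w k l - Sigma0 k l| |)%R].
have mbad : measurable bad.
  rewrite -[X in measurable X]setTI.
  have mZ : measurable_fun setT (fun w => `|\sum_k \sum_l `|Q n w k l - Sigma0 k l| |).
    by apply: measurableT_comp => //; exact: Zcvg.1.
  have := measurable_fun_ler (measurable_cst e) mZ.
  by move=> /(_ measurableT [set true]); apply.
apply: (@le_trans _ _ (P (~` bad))).
  rewrite probability_setC// EFinB leeB//; exact: uP.
apply: le_measure; rewrite ?inE//; first exact: measurableC.
(* Off [bad] every entry of [Q n w] is within [e] of that of [Sigma0], being controlled by one term
   of a nonnegative sum; the uniform bound then applies at the estimator, whatever its value in
   [Theta]. *)
move=> w /= /negP; rewrite -ltNge => small.
apply: lt_le_trans nc _; rewrite ler_wpM2l// ltW//.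
apply: cP; last exact: hatTheta_in.
move=> i j; apply: le_lt_trans small.
rewrite [leRHS]ger0_norm; last by apply: sumr_ge0 => k _; apply: sumr_ge0.
rewrite (bigD1 i)//= (bigD1 j)//= -addrA lerDl addr_ge0//.
  by apply: sumr_ge0.
by apply: sumr_ge0 => k _; apply: sumr_ge0.
Qed.
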